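(* Let $\gamma:\mathbb{R}^2\to\mathbb{R}^{2,1}$, $(x,t)\mapsto\gamma(x,t)$, be a smooth solution of the $\ast$-MCF $\gamma_t=\frac12\ast_\gamma H(\gamma(\cdot,t))$ with $\langle\gamma_x,\gamma_x\rangle=-1$ (a time-like solution). Then there exists a smooth $g=(e_0,e_1,e_2):\mathbb{R}^2\to SO(1,2)$ with $e_0=\gamma_x$ such that $$g^{-1}g_x=\begin{pmatrix}0&k_1&k_2\\k_1&0&0\\k_2&0&0\end{pmatrix}$$ for some real functions $k_1,k_2$, and $q=\frac12(k_1+ik_2)$ is a solution of the defocusing NLS $q_t=\frac i2(q_{xx}-2|q|^2q)$. Moreover, if $\tilde g:\mathbb{R}^2\to SO(1,2)$ is another map satisfying these conditions, with corresponding $\tilde k_1,\tilde k_2$, then there exists a constant $R(c)\in SO(2)$ such that $\tilde g=g\,\mathrm{diag}(1,R(c))$ and $\tilde k_1+i\tilde k_2=e^{-ic}(k_1+ik_2)$.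
   Context: $\mathbb{R}^{2,1}$ is $\mathbb{R}^3$ with the bilinear form $\langle v,w\rangle=-v_1w_1+v_2w_2+v_3w_3$. With $D_2=\mathrm{diag}(-1,1,1)$, $SO(1,2)=\{A\in GL(3,\mathbb{R}):A^tD_2A=D_2,\ \det A=1\}$. $R(c)=\begin{pmatrix}\cos c&-\sin c\\ \sin c&\cos c\end{pmatrix}$. For a curve with $\langle\gamma_x,\gamma_x\rangle=-1$, $H(\gamma)=\gamma_{xx}$ is the mean curvature vector, a section of the (space-like) normal plane bundle $\gamma_x^\perp$. The normal plane at each point is oriented so that a basis $(v_1,v_2)$ is positive iff $\det(\gamma_x,v_1,v_2)>0$, and $\ast_\gamma$ is the Hodge star on it, i.e. rotation by $\pi/2$: $\ast e_1=e_2$, $\ast e_2=-e_1$ for a positively oriented orthonormal basis $(e_1,e_2)$.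
   Formalization: The ''moreover'' part is proved only when H(γ(·,t)) is not identically zero for a dense set of times t; without this it is false: for the line γ=(x,0,0), g=I and g̃=diag(1,R(t)) both satisfy the conditions but differ by a non-constant rotation. *)

(* Defs.v *)
(* Real and complex analysis is Coquelicot's, on the real numbers of Stdlib;
   matrices are those of MathComp, the field structure on R coming from
   Rstruct. *)
From mathcomp Require Import all_boot all_algebra.
From Stdlib Require Import Reals.
From mathcomp Require Import Rstruct.
From Coquelicot Require Import Coquelicot.

Set Implicit Arguments.
Unset Strict Implicit.
Unset Printing Implicit Defensive.

Import GRing.Theory.
Local Open Scope ring_scope.

Definition smooth (f : R -> R -> R) : Prop :=
  forall (n : nat) (x t : R), ex_diff_n f n x t.

Definition smooth_mx (m n : nat) (A : R -> R -> 'M[R]_(m, n)) : Prop :=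
  forall i j, smooth (fun x t => A x t i j).

Definition mx_dx (m n : nat) (A : R -> R -> 'M[R]_(m, n)) (x t : R) :
    'M[R]_(m, n) :=
  \matrix_(i, j) Derive (fun s => A s t i j) x.

Definition mx_dt (m n : nat) (A : R -> R -> 'M[R]_(m, n)) (x t : R) :
    'M[R]_(m, n) :=
  \matrix_(i, j) Derive (fun s => A x s i j) t.

Definition C_dx (q : R -> R -> C) (x t : R) : C :=
  (Derive (fun s => Re (q s t)) x, Derive (fun s => Im (q s t)) x).

Definition C_dt (q : R -> R -> C) (x t : R) : C :=
  (Derive (fun s => Re (q x s)) t, Derive (fun s => Im (q x s)) t).

Definition mx3 (s : seq (seq R)) : 'M[R]_3 :=
  \matrix_(i, j) nth 0 (nth [::] s i) j.

Definition cols3 (u v w : 'cV[R]_3) : 'M[R]_3 :=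
  \matrix_(i, j) (nth 0 [:: u; v; w] j) i 0.

Definition lorentz (v w : 'cV[R]_3) :=
  - (v 0 0 * w 0 0) + v 1 0 * w 1 0 + v 2%:R 0 * w 2%:R 0.

Definition D2 : 'M[R]_3 :=
  mx3 [:: [:: -1; 0; 0];
          [::  0; 1; 0];
          [::  0; 0; 1] ].

Definition SO12 (A : 'M[R]_3) : Prop :=
  [/\ A \in unitmx, A^T *m D2 *m A = D2 & \det A = 1].

Definition rot2 (c : R) : 'M[R]_2 :=
  \matrix_(i, j) nth 0 (nth [::] [:: [:: cos c; - sin c];
                                     [:: sin c;   cos c] ] i) j.

Definition diag1_rot (c : R) : 'M[R]_3 := lift0_mx (rot2 c).

Definition expi (c : R) : C := (cos c, sin c).

Definition pos_onb_normal (n e1 e2 : 'cV[R]_3) : Prop :=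
  [/\ lorentz n e1 = 0 /\ lorentz n e2 = 0,
      [/\ lorentz e1 e1 = 1, lorentz e2 e2 = 1 & lorentz e1 e2 = 0]
    & Rlt 0 (\det (cols3 n e1 e2))].

(* [hodge_star n v w]: v lies in the plane orthogonal to n and w = * v.
   For time-like n such bases exist and w does not depend on the one chosen. *)
Definition hodge_star (n v w : 'cV[R]_3) : Prop :=
  exists (e1 e2 : 'cV[R]_3) (a b : R),
    [/\ pos_onb_normal n e1 e2,
        v = a *: e1 + b *: e2
      & w = a *: e2 - b *: e1].

Definition mean_curvature (gamma : R -> R -> 'cV[R]_3) : R -> R -> 'cV[R]_3 :=
  mx_dx (mx_dx gamma).

Definition timelike_star_MCF (gamma : R -> R -> 'cV[R]_3) : Prop :=
  [/\ smooth_mx gamma,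
      forall x t, lorentz (mx_dx gamma x t) (mx_dx gamma x t) = -1
    & forall x t, exists w : 'cV[R]_3,
        hodge_star (mx_dx gamma x t) (mean_curvature gamma x t) w /\
        mx_dt gamma x t = 2%:R^-1 *: w].

Definition defocusing_NLS (q : R -> R -> C) : Prop :=
  forall x t : R,
    C_dt q x t
    = (Ci / RtoC 2 * (C_dx (C_dx q) x t
                      - RtoC 2 * RtoC (Cmod (q x t) ^ 2) * q x t))%C.

Definition adapted_frame (gamma : R -> R -> 'cV[R]_3) (g : R -> R -> 'M[R]_3)
    (k1 k2 : R -> R -> R) : Prop :=
  [/\ smooth_mx g,
      forall x t, SO12 (g x t),
      forall x t, col 0 (g x t) = mx_dx gamma x t,
      forall x t, invmx (g x t) *m mx_dx g x t
                  = mx3 [:: [:: 0;      k1 x t; k2 x t];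
                            [:: k1 x t; 0;      0     ];
                            [:: k2 x t; 0;      0     ] ]
    & defocusing_NLS (fun x t => (RtoC (/ 2) * (k1 x t, k2 x t))%C)].

(* H(gamma(., t)) is not identically zero for t in a dense set of times.  On an
   open time interval where H vanishes, gamma(., t) is a fixed line, k1 = k2 =
   0, and g may be multiplied by diag(1, R(c(t))) with c any smooth function of
   t, so that uniqueness of the frame up to a constant rotation fails. *)
Definition curved_at_dense_times (gamma : R -> R -> 'cV[R]_3) : Prop :=
  forall a b : R, Rlt a b ->
    exists x t : R, [/\ Rlt a t, Rlt t b & mean_curvature gamma x t <> 0].

(* Main.v *)
(* A smooth frame g : R^2 -> SO(1,2) along e0 = gamma_x has
   g_x = g A and g_t = g B with
     A = so12 k1 k2 w,  B = so12 a b v,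
   where w and v are the rotation speeds of (e1, e2) in the normal plane.  The
   flow determines the first column of B from A, and then the zero curvature
   equation A_t - B_x = A B - B A yields v_x - w_t = (|k|^2 / 4)_x.  So
   (- w, |k|^2 / 4 - v) is the gradient of a function theta, and rotating
   (e1, e2) by theta produces a frame with w = 0 and v = |k|^2 / 4; for such a
   frame the remaining two curvature equations are the NLS.
     Conversely, in any frame with w = 0, v - |k|^2 / 4 depends on t only, and
   the NLS says that it is killed by k = (k1, k2), hence it vanishes at the
   dense set of times when the curve is not a line.  Two such frames differ by
   a rotation whose angle has x-derivative w' - w = 0 and t-derivative
   v' - v = (|k'|^2 - |k|^2) / 4 = 0.
     An initial frame exists globally because the hyperboloid of unit time-like
   vectors has an explicit section into SO(1,2), given by boosts. *)
Require Import Defs.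
From mathcomp Require Import all_boot all_algebra.
From Stdlib Require Import Reals FunctionalExtensionality.
From mathcomp Require Import Rstruct.
From Coquelicot Require Import Coquelicot.
From mathcomp Require Import ring lra.
Set Implicit Arguments.
Unset Strict Implicit.
Unset Printing Implicit Defensive.

Import GRing.Theory Num.Theory.
Local Open Scope ring_scope.

(** * Smooth functions of two variables *)

Definition dx (f : R -> R -> R) (x t : R) : R := Derive (fun s => f s t) x.
Definition dt (f : R -> R -> R) (x t : R) : R := Derive (fun s => f x s) t.

Lemma fun2_ext (f g : R -> R -> R) : (forall x t, f x t = g x t) -> f = g.
Proof.
by move=> e; apply: functional_extensionality => x; apply: functional_extensionality.
Qed.

(** [smooth] is [Cn n] for every [n]. Fixing the order allows the closure properties below to be
    proved by induction on it. *)
Definition Cn (n : nat) (f : R -> R -> R) := forall x t, ex_diff_n f n x t.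

Lemma CnS n f : Cn n.+1 f <->
  [/\ forall x t, continuity_2d_pt f x t,
      forall x t, ex_derive (fun s => f s t) x /\ ex_derive (fun s => f x s) t,
      Cn n (dx f) & Cn n (dt f)].
Proof.
split=> [h|[h1 h2 h3 h4] x t].
  by split=> x t; have [? [? [? [? ?]]]] := h x t.
by have [? ?] := h2 x t; do !split.
Qed.

Lemma Cn_continuity n f : Cn n f -> forall x t, continuity_2d_pt f x t.
Proof. by case: n => [|n] h x t; case: (h x t). Qed.

Lemma CnW n f : Cn n.+1 f -> Cn n f.
Proof.
elim: n f => [|n IHn] f h x t; first by split=> //; exact: (Cn_continuity h).
by move: x t; have [h1 h2 h3 h4] := (CnS _ _).1 h; apply/CnS; split=> //; exact: IHn.
Qed.

Lemma smooth_dx f : smooth f -> smooth (dx f).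
Proof. by move=> h n; have [] := (CnS _ _).1 (h n.+1). Qed.

Lemma smooth_dt f : smooth f -> smooth (dt f).
Proof. by move=> h n; have [] := (CnS _ _).1 (h n.+1). Qed.

Lemma smooth_continuity f x t : smooth f -> continuity_2d_pt f x t.
Proof. by move=> h; exact: (Cn_continuity (h 0%N)). Qed.

Lemma smooth_ex_dx f x t : smooth f -> ex_derive (fun s => f s t) x.
Proof. by move=> h; have [_ /(_ x t)[]] := (CnS _ _).1 (h 1%N). Qed.

Lemma smooth_ex_dt f x t : smooth f -> ex_derive (fun s => f x s) t.
Proof. by move=> h; have [_ /(_ x t)[]] := (CnS _ _).1 (h 1%N). Qed.

Lemma is_dx f x t : smooth f -> is_derive (fun s => f s t) x (dx f x t).
Proof. by move=> h; apply: Derive_correct; exact: smooth_ex_dx. Qed.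

Lemma is_dt f x t : smooth f -> is_derive (fun s => f x s) t (dt f x t).
Proof. by move=> h; apply: Derive_correct; exact: smooth_ex_dt. Qed.

Lemma Cn_const n (c : R) : Cn n (fun _ _ => c).
Proof.
elim: n c => [|n IHn] c; first by split=> //; exact: continuity_2d_pt_const.
apply/CnS; split.
- by move=> x t; exact: continuity_2d_pt_const.
- by move=> x t; split; exact: ex_derive_const.
- have -> : dx (fun _ _ => c) = fun _ _ => 0 by apply: fun2_ext => x t; exact: Derive_const.
  exact: IHn.
- have -> : dt (fun _ _ => c) = fun _ _ => 0 by apply: fun2_ext => x t; exact: Derive_const.
  exact: IHn.
Qed.

Lemma Cn_add n f g : Cn n f -> Cn n g -> Cn n (fun x t => f x t + g x t).
Proof.
elim: n f g => [|n IHn] f g hf hg.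
  by move=> x t; split=> //; apply: continuity_2d_pt_plus; exact: (@Cn_continuity 0).
have [f1 f2 f3 f4] := (CnS _ _).1 hf; have [g1 g2 g3 g4] := (CnS _ _).1 hg.
apply/CnS; split.
- by move=> x t; exact: continuity_2d_pt_plus.
- move=> x t; have [? ?] := f2 x t; have [? ?] := g2 x t.
  by split; apply: (@ex_derive_plus R_AbsRing R_NormedModule).
- have -> : dx (fun x t => f x t + g x t) = fun x t => dx f x t + dx g x t.
    by apply: fun2_ext => x t; apply: Derive_plus; [case: (f2 x t)|case: (g2 x t)].
  exact: IHn.
- have -> : dt (fun x t => f x t + g x t) = fun x t => dt f x t + dt g x t.
    by apply: fun2_ext => x t; apply: Derive_plus; [case: (f2 x t)|case: (g2 x t)].
  exact: IHn.
Qed.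

Lemma Cn_mul n f g : Cn n f -> Cn n g -> Cn n (fun x t => f x t * g x t).
Proof.
elim: n f g => [|n IHn] f g hf hg.
  by move=> x t; split=> //; apply: continuity_2d_pt_mult; exact: (@Cn_continuity 0).
have [f1 f2 f3 f4] := (CnS _ _).1 hf; have [g1 g2 g3 g4] := (CnS _ _).1 hg.
apply/CnS; split.
- by move=> x t; exact: continuity_2d_pt_mult.
- move=> x t; have [? ?] := f2 x t; have [? ?] := g2 x t.
  by split; apply: ex_derive_mult.
- have -> : dx (fun x t => f x t * g x t) = fun x t => dx f x t * g x t + f x t * dx g x t.
    by apply: fun2_ext => x t; apply: Derive_mult; [case: (f2 x t)|case: (g2 x t)].
  (* Each Leibniz term keeps one factor undifferentiated, which has order [n.+1] and is lowered to
     order [n]. *)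
  by apply: Cn_add; apply: IHn => //; exact: CnW.
- have -> : dt (fun x t => f x t * g x t) = fun x t => dt f x t * g x t + f x t * dt g x t.
    by apply: fun2_ext => x t; apply: Derive_mult; [case: (f2 x t)|case: (g2 x t)].
  by apply: Cn_add; apply: IHn => //; exact: CnW.
Qed.

Lemma Cn_opp n f : Cn n f -> Cn n (fun x t => - f x t).
Proof.
move=> h; have -> : (fun x t => - f x t) = fun x t => -1 * f x t.
  by apply: fun2_ext => x t; rewrite mulN1r.
by apply: Cn_mul => //; exact: Cn_const.
Qed.

(** The partials of [1/f] are [- f' * (1/f)^2], so order [n.+1] for [1/f] reduces to order [n] for
    [f'] and for [1/f] itself. *)
Lemma Cn_inv n f : (forall x t, f x t <> 0) -> Cn n f -> Cn n (fun x t => (f x t)^-1).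
Proof.
move=> f0; elim: n => [|n IHn] hf.
  by move=> x t; split=> //; apply: continuity_2d_pt_inv => //; exact: (@Cn_continuity 0).
have [f1 f2 f3 f4] := (CnS _ _).1 hf.
have hi := IHn (CnW hf).
have e x t (g : R) : Rdiv (- g) (f x t ^ 2)%R = - (g * ((f x t)^-1 * (f x t)^-1)).
  by rewrite RdivE RpowE expr2 invfM mulNr.
apply/CnS; split.
- by move=> x t; exact: continuity_2d_pt_inv.
- move=> x t; have [? ?] := f2 x t.
  by split; apply: ex_derive_inv.
- have -> : dx (fun x t => (f x t)^-1) = fun x t => - (dx f x t * ((f x t)^-1 * (f x t)^-1)).
    by apply: fun2_ext => x t; rewrite -e; apply: Derive_inv => //; case: (f2 x t).
  by apply: Cn_opp; apply: Cn_mul => //; apply: Cn_mul.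
- have -> : dt (fun x t => (f x t)^-1) = fun x t => - (dt f x t * ((f x t)^-1 * (f x t)^-1)).
    by apply: fun2_ext => x t; rewrite -e; apply: Derive_inv => //; case: (f2 x t).
  by apply: Cn_opp; apply: Cn_mul => //; apply: Cn_mul.
Qed.

Lemma is_derive_cos_comp (f : R -> R) (x l : R) :
  is_derive f x l -> is_derive (fun s => cos (f s)) x (- (l * sin (f x))).
Proof.
move=> h; rewrite -mulrN; apply: (is_derive_comp cos f) => //; exact: is_derive_cos.
Qed.

Lemma is_derive_sin_comp (f : R -> R) (x l : R) :
  is_derive f x l -> is_derive (fun s => sin (f s)) x (l * cos (f x)).
Proof.
move=> h; apply: (is_derive_comp sin f) => //; exact: is_derive_sin.
Qed.

(** The two claims share one induction because the derivative of each function contains the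
    other. *)
Lemma Cn_cos_sin n f : Cn n f ->
  Cn n (fun x t => cos (f x t)) /\ Cn n (fun x t => sin (f x t)).
Proof.
elim: n => [|n IHn] hf.
  split=> x t; split=> //; have fc := Cn_continuity hf x t.
    by apply: continuity_1d_2d_pt_comp => //; exact: continuity_cos.
  by apply: continuity_1d_2d_pt_comp => //; exact: continuity_sin.
have [f1 f2 f3 f4] := (CnS _ _).1 hf.
have [hc hs] := IHn (CnW hf).
have dfx x t : is_derive (fun s => f s t) x (dx f x t).
  by apply: Derive_correct; case: (f2 x t).
have dft x t : is_derive (fun s => f x s) t (dt f x t).
  by apply: Derive_correct; case: (f2 x t).
split; apply/CnS; split.
- by move=> x t; apply: continuity_1d_2d_pt_comp => //; exact: continuity_cos.
- move=> x t; split; eexists.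
    exact: (is_derive_cos_comp (dfx x t)).
  exact: (is_derive_cos_comp (dft x t)).
- have -> : dx (fun x t => cos (f x t)) = fun x t => - (dx f x t * sin (f x t)).
    by apply: fun2_ext => x t; apply: is_derive_unique; exact: (is_derive_cos_comp (dfx x t)).
  by apply: Cn_opp; apply: Cn_mul.
- have -> : dt (fun x t => cos (f x t)) = fun x t => - (dt f x t * sin (f x t)).
    by apply: fun2_ext => x t; apply: is_derive_unique; exact: (is_derive_cos_comp (dft x t)).
  by apply: Cn_opp; apply: Cn_mul.
- by move=> x t; apply: continuity_1d_2d_pt_comp => //; exact: continuity_sin.
- move=> x t; split; eexists.
    exact: (is_derive_sin_comp (dfx x t)).
  exact: (is_derive_sin_comp (dft x t)).
- have -> : dx (fun x t => sin (f x t)) = fun x t => (dx f x t * cos (f x t)).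
    by apply: fun2_ext => x t; apply: is_derive_unique; exact: (is_derive_sin_comp (dfx x t)).
  exact: Cn_mul.
- have -> : dt (fun x t => sin (f x t)) = fun x t => (dt f x t * cos (f x t)).
    by apply: fun2_ext => x t; apply: is_derive_unique; exact: (is_derive_sin_comp (dft x t)).
  exact: Cn_mul.
Qed.

Lemma smooth_const (c : R) : smooth (fun _ _ => c).
Proof. by move=> n; exact: Cn_const. Qed.
Arguments smooth_const c%_ring_scope.

Lemma smooth_add f g : smooth f -> smooth g -> smooth (fun x t => f x t + g x t).
Proof. by move=> hf hg n; exact: Cn_add (hf n) (hg n). Qed.

Lemma smooth_mul f g : smooth f -> smooth g -> smooth (fun x t => f x t * g x t).
Proof. by move=> hf hg n; exact: Cn_mul (hf n) (hg n). Qed.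

Lemma smooth_opp f : smooth f -> smooth (fun x t => - f x t).
Proof. by move=> hf n; exact: Cn_opp (hf n). Qed.

Lemma smooth_inv f : (forall x t, f x t <> 0) -> smooth f -> smooth (fun x t => (f x t)^-1).
Proof. by move=> f0 hf n; exact: Cn_inv (hf n). Qed.

Lemma smooth_cos f : smooth f -> smooth (fun x t => cos (f x t)).
Proof. by move=> hf n; case: (Cn_cos_sin (hf n)). Qed.

Lemma smooth_sin f : smooth f -> smooth (fun x t => sin (f x t)).
Proof. by move=> hf n; case: (Cn_cos_sin (hf n)). Qed.

Lemma dxD f g x t : smooth f -> smooth g ->
  dx (fun x t => f x t + g x t) x t = dx f x t + dx g x t.
Proof. by move=> hf hg; apply: Derive_plus; exact: smooth_ex_dx. Qed.

Lemma dtD f g x t : smooth f -> smooth g ->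
  dt (fun x t => f x t + g x t) x t = dt f x t + dt g x t.
Proof. by move=> hf hg; apply: Derive_plus; exact: smooth_ex_dt. Qed.

Lemma dxM f g x t : smooth f -> smooth g ->
  dx (fun x t => f x t * g x t) x t = dx f x t * g x t + f x t * dx g x t.
Proof.
by move=> hf hg; apply: Derive_mult; [exact: smooth_ex_dx hf|exact: smooth_ex_dx hg].
Qed.

Lemma dtM f g x t : smooth f -> smooth g ->
  dt (fun x t => f x t * g x t) x t = dt f x t * g x t + f x t * dt g x t.
Proof.
by move=> hf hg; apply: Derive_mult; [exact: smooth_ex_dt hf|exact: smooth_ex_dt hg].
Qed.

Lemma dxN f x t : dx (fun x t => - f x t) x t = - dx f x t.
Proof. exact: Derive_opp. Qed.

Lemma dtN f x t : dt (fun x t => - f x t) x t = - dt f x t.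
Proof. exact: Derive_opp. Qed.

Lemma dxC c x t : dx (fun _ _ => c) x t = 0.
Proof. exact: Derive_const. Qed.

Lemma dtC c x t : dt (fun _ _ => c) x t = 0.
Proof. exact: Derive_const. Qed.

Lemma dx_cos f x t : smooth f ->
  dx (fun x t => cos (f x t)) x t = - (dx f x t * sin (f x t)).
Proof. by move=> h; apply: is_derive_unique; exact: (is_derive_cos_comp (is_dx x t h)). Qed.

Lemma dx_sin f x t : smooth f ->
  dx (fun x t => sin (f x t)) x t = dx f x t * cos (f x t).
Proof. by move=> h; apply: is_derive_unique; exact: (is_derive_sin_comp (is_dx x t h)). Qed.

Lemma dt_cos f x t : smooth f ->
  dt (fun x t => cos (f x t)) x t = - (dt f x t * sin (f x t)).
Proof. by move=> h; apply: is_derive_unique; exact: (is_derive_cos_comp (is_dt x t h)). Qed.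

Lemma dt_sin f x t : smooth f ->
  dt (fun x t => sin (f x t)) x t = dt f x t * cos (f x t).
Proof. by move=> h; apply: is_derive_unique; exact: (is_derive_sin_comp (is_dt x t h)). Qed.

Lemma dx_dt f x t : smooth f -> dx (dt f) x t = dt (dx f) x t.
Proof.
move=> h; apply: Schwarz.
- apply: locally_2d_forall => u v; split; last split; last split.
  + exact: smooth_ex_dx.
  + exact: smooth_ex_dt.
  + exact: (smooth_ex_dx u v (smooth_dt h)).
  + exact: (smooth_ex_dt u v (smooth_dx h)).
- exact: (smooth_continuity x t (smooth_dx (smooth_dt h))).
- exact: (smooth_continuity x t (smooth_dt (smooth_dx h))).
Qed.

(** * Recovering a function from its partial derivatives *)

Lemma is_derive0_const (f : R -> R) : (forall x, is_derive f x 0) -> forall x y, f x = f y.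
Proof.
move=> h x y; have [lt|[->//|lt]] := Rtotal_order x y.
  by apply: eq_is_derive lt => z _; exact: h.
by symmetry; apply: eq_is_derive lt => z _; exact: h.
Qed.

Lemma dx0_const f t : smooth f -> (forall x, dx f x t = 0) -> forall x y, f x t = f y t.
Proof. by move=> h e; apply: is_derive0_const => x; rewrite -(e x); exact: is_dx. Qed.

Lemma dt0_const f x : smooth f -> (forall t, dt f x t = 0) -> forall t s, f x t = f x s.
Proof. by move=> h e; apply: is_derive0_const => t; rewrite -(e t); exact: is_dt. Qed.

(** Joint continuity of [f] is the only point at issue, the higher orders being those of [p] and
    [q]. It follows from differentiability: both partials exist and the one in [x] is continuous. *)
Lemma smooth_of_partials (f p q : R -> R -> R) : smooth p -> smooth q ->
  (forall x t, is_derive (fun s => f s t) x (p x t)) ->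
  (forall x t, is_derive (fun s => f x s) t (q x t)) -> smooth f.
Proof.
move=> hp hq fp fq.
have fc x t : continuity_2d_pt f x t.
  apply: differentiable_continuity_pt; exists (p x t), (q x t).
  apply/filterdiff_differentiable_pt_lim.
  apply: (@is_derive_filterdiff f x t p (q x t)) => //.
    by apply: filter_forall => u; exact: fp.
  exact: (continuity_2d_pt_filterlim _ _ _).1 (smooth_continuity x t hp).
case=> [|n] x t; first by split.
move: x t; apply/CnS; split=> //.
- by move=> x t; split; eexists; [exact: fp|exact: fq].
- have -> : dx f = p by apply: fun2_ext => x t; exact: is_derive_unique.
  exact: hp.
- have -> : dt f = q by apply: fun2_ext => x t; exact: is_derive_unique.
  exact: hq.
Qed.

Lemma smooth_continuous_x f x t : smooth f -> continuous (fun s => f s t) x.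
Proof. by move=> h; apply: ex_derive_continuous; exact: smooth_ex_dx. Qed.

Lemma smooth_continuous_t f x t : smooth f -> continuous (fun s => f x s) t.
Proof. by move=> h; apply: ex_derive_continuous; exact: smooth_ex_dt. Qed.

Lemma continuity_2d_swap f x t :
  continuity_2d_pt f x t -> continuity_2d_pt (fun u v => f v u) t x.
Proof.
by move=> h e; have [d hd] := h e; exists d => u v hu hv; exact: hd.
Qed.

(** The potential is the integral of [p dx + q dt] along the broken path from the origin to [(0, t)]
    and then to [(x, t)]. *)
Lemma poincare (p q : R -> R -> R) : smooth p -> smooth q ->
  (forall x t, dt p x t = dx q x t) ->
  exists f, [/\ smooth f, forall x t, dx f x t = p x t & forall x t, dt f x t = q x t].
Proof.
move=> hp hq pq.
pose f x t : R := RInt (fun s => p s t) 0 x + RInt (fun s => q 0 s) 0 t.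
have exp t a b : ex_RInt (fun s => p s t) a b.
  by apply: (@ex_RInt_continuous R_CompleteNormedModule) => z _; exact: smooth_continuous_x.
have exq t a b : ex_RInt (fun s => q t s) a b.
  by apply: (@ex_RInt_continuous R_CompleteNormedModule) => z _; exact: smooth_continuous_t.
have fp x t : is_derive (fun s => f s t) x (p x t).
  rewrite -[p x t]addr0; apply: (@is_derive_plus R_AbsRing R_NormedModule).
    apply: (is_derive_RInt (fun s => p s t)).
      by apply: filter_forall => b; apply: RInt_correct.
    exact: smooth_continuous_x.
  exact: is_derive_const.
have fq x t : is_derive (fun s => f x s) t (q x t).
  have -> : q x t = (q x t - q 0 t) + q 0 t by rewrite addrNK.
  apply: (@is_derive_plus R_AbsRing R_NormedModule); last first.
    apply: (is_derive_RInt (fun s => q 0 s)).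
      by apply: filter_forall => b; apply: RInt_correct.
    exact: smooth_continuous_t.
  (* The horizontal integral of [p] is differentiated in [t] under the integral sign. Closedness
     replaces [dt p] by [dx q], whose integral from 0 to [x] is [q x t - q 0 t]; the vertical
     integral supplies the missing [q 0 t]. *)
  have -> : q x t - q 0 t = RInt (fun s => Derive (fun z => p s z) t) 0 x.
    have <- : RInt (Derive (fun s => q s t)) 0 x = q x t - q 0 t.
      apply: RInt_Derive => s _; first exact: smooth_ex_dx.
      exact: (@smooth_continuous_x (dx q) s t (smooth_dx hq)).
    by apply: RInt_ext => s _; rewrite -/(dt p s t) pq.
  apply: (is_derive_RInt_param (fun z s => p s z)).
  - by apply: filter_forall => z s _; exact: smooth_ex_dt.
  - move=> s _; apply: (@continuity_2d_swap (dt p)).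
    exact: (smooth_continuity s t (smooth_dt hp)).
  - by apply: filter_forall.
exists f; split.
- exact: (smooth_of_partials hp hq).
- by move=> x t; exact: is_derive_unique.
- by move=> x t; exact: is_derive_unique.
Qed.

(** * Smooth matrix-valued functions *)

Lemma smooth_sum (I : Type) (r : seq I) (F : I -> R -> R -> R) :
  (forall i, smooth (F i)) -> smooth (fun x t => \sum_(i <- r) F i x t).
Proof.
move=> hF; elim: r => [|i r IHr].
  have -> : (fun x t => \sum_(i <- [::]) F i x t) = fun _ _ => 0.
    by apply: fun2_ext => x t; rewrite big_nil.
  exact: smooth_const.
have -> : (fun x t => \sum_(j <- i :: r) F j x t)
          = fun x t => F i x t + \sum_(j <- r) F j x t.
  by apply: fun2_ext => x t; rewrite big_cons.
exact: smooth_add.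
Qed.

Lemma dx_sum (I : Type) (r : seq I) (F : I -> R -> R -> R) x t :
  (forall i, smooth (F i)) ->
  dx (fun x t => \sum_(i <- r) F i x t) x t = \sum_(i <- r) dx (F i) x t.
Proof.
move=> hF; elim: r => [|i r IHr].
  have -> : (fun x t => \sum_(i <- [::]) F i x t) = fun _ _ => 0.
    by apply: fun2_ext => x' t'; rewrite big_nil.
  by rewrite big_nil dxC.
have -> : (fun x t => \sum_(j <- i :: r) F j x t)
          = fun x t => F i x t + \sum_(j <- r) F j x t.
  by apply: fun2_ext => x' t'; rewrite big_cons.
by rewrite big_cons dxD ?IHr //; exact: smooth_sum.
Qed.

Lemma dt_sum (I : Type) (r : seq I) (F : I -> R -> R -> R) x t :
  (forall i, smooth (F i)) ->
  dt (fun x t => \sum_(i <- r) F i x t) x t = \sum_(i <- r) dt (F i) x t.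
Proof.
move=> hF; elim: r => [|i r IHr].
  have -> : (fun x t => \sum_(i <- [::]) F i x t) = fun _ _ => 0.
    by apply: fun2_ext => x' t'; rewrite big_nil.
  by rewrite big_nil dtC.
have -> : (fun x t => \sum_(j <- i :: r) F j x t)
          = fun x t => F i x t + \sum_(j <- r) F j x t.
  by apply: fun2_ext => x' t'; rewrite big_cons.
by rewrite big_cons dtD ?IHr //; exact: smooth_sum.
Qed.

Lemma mxfun_ext (m n : nat) (A B : R -> R -> 'M[R]_(m, n)) :
  (forall x t, A x t = B x t) -> A = B.
Proof.
by move=> e; apply: functional_extensionality => x; apply: functional_extensionality.
Qed.

Lemma mx_dxE (m n : nat) (A : R -> R -> 'M[R]_(m, n)) x t i j :
  mx_dx A x t i j = dx (fun x t => A x t i j) x t.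
Proof. by rewrite mxE. Qed.

Lemma mx_dtE (m n : nat) (A : R -> R -> 'M[R]_(m, n)) x t i j :
  mx_dt A x t i j = dt (fun x t => A x t i j) x t.
Proof. by rewrite mxE. Qed.

Lemma smooth_mx_dx (m n : nat) (A : R -> R -> 'M[R]_(m, n)) :
  smooth_mx A -> smooth_mx (mx_dx A).
Proof.
move=> h i j; have -> : (fun x t => mx_dx A x t i j) = dx (fun x t => A x t i j).
  by apply: fun2_ext => x t; exact: mx_dxE.
exact: smooth_dx.
Qed.

Lemma smooth_mx_dt (m n : nat) (A : R -> R -> 'M[R]_(m, n)) :
  smooth_mx A -> smooth_mx (mx_dt A).
Proof.
move=> h i j; have -> : (fun x t => mx_dt A x t i j) = dt (fun x t => A x t i j).
  by apply: fun2_ext => x t; exact: mx_dtE.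
exact: smooth_dt.
Qed.

Lemma mx_dx_dt (m n : nat) (A : R -> R -> 'M[R]_(m, n)) x t :
  smooth_mx A -> mx_dx (mx_dt A) x t = mx_dt (mx_dx A) x t.
Proof.
move=> h; apply/matrixP => i j; rewrite mx_dxE mx_dtE.
have -> : (fun x t => mx_dx A x t i j) = dx (fun x t => A x t i j).
  by apply: fun2_ext => x' t'; exact: mx_dxE.
have -> : (fun x t => mx_dt A x t i j) = dt (fun x t => A x t i j).
  by apply: fun2_ext => x' t'; exact: mx_dtE.
exact: dx_dt.
Qed.

Section Product.

Variables (m n p : nat) (A : R -> R -> 'M[R]_(m, n)) (B : R -> R -> 'M[R]_(n, p)).
Hypotheses (hA : smooth_mx A) (hB : smooth_mx B).

(** The summand stays an unreduced application, in the shape [F i x t] that [smooth_sum], [dx_sum]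
    and [dt_sum] match. *)
Let mulE i j : (fun x t => (A x t *m B x t) i j) =
  (fun x t => \sum_k (fun k x t => A x t i k * B x t k j) k x t).
Proof. by apply: fun2_ext => x t; rewrite mxE. Qed.

Let smooth_coef i j k : smooth (fun x t => A x t i k * B x t k j).
Proof. exact: smooth_mul. Qed.

Lemma smooth_mulmx : smooth_mx (fun x t => A x t *m B x t).
Proof. by move=> i j; rewrite mulE; exact: smooth_sum. Qed.

Lemma mx_dxM x t :
  mx_dx (fun x t => A x t *m B x t) x t = mx_dx A x t *m B x t + A x t *m mx_dx B x t.
Proof.
apply/matrixP => i j; rewrite mx_dxE mulE dx_sum ?mxE -?big_split //=.
by apply: eq_bigr => k _; rewrite dxM ?mx_dxE //.
Qed.

Lemma mx_dtM x t :
  mx_dt (fun x t => A x t *m B x t) x t = mx_dt A x t *m B x t + A x t *m mx_dt B x t.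
Proof.
apply/matrixP => i j; rewrite mx_dtE mulE dt_sum ?mxE -?big_split //=.
by apply: eq_bigr => k _; rewrite dtM ?mx_dtE //.
Qed.

End Product.

Lemma smooth_mx_const (m n : nat) (A : 'M[R]_(m, n)) : smooth_mx (fun _ _ => A).
Proof. by move=> i j; exact: smooth_const. Qed.

Lemma mx_dx_const (m n : nat) (A : 'M[R]_(m, n)) x t : mx_dx (fun _ _ => A) x t = 0.
Proof. by apply/matrixP => i j; rewrite mx_dxE dxC mxE. Qed.

Lemma mx_dt_const (m n : nat) (A : 'M[R]_(m, n)) x t : mx_dt (fun _ _ => A) x t = 0.
Proof. by apply/matrixP => i j; rewrite mx_dtE dtC mxE. Qed.

Lemma smooth_trmx (m n : nat) (A : R -> R -> 'M[R]_(m, n)) :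
  smooth_mx A -> smooth_mx (fun x t => (A x t)^T).
Proof.
move=> h i j; have -> : (fun x t => (A x t)^T i j) = fun x t => A x t j i.
  by apply: fun2_ext => x t; rewrite mxE.
exact: h.
Qed.

Lemma mx_dx_tr (m n : nat) (A : R -> R -> 'M[R]_(m, n)) x t :
  mx_dx (fun x t => (A x t)^T) x t = (mx_dx A x t)^T.
Proof.
apply/matrixP => i j; rewrite [RHS]mxE !mx_dxE.
by congr dx; apply: fun2_ext => ? ?; rewrite mxE.
Qed.

Lemma mx_dt_tr (m n : nat) (A : R -> R -> 'M[R]_(m, n)) x t :
  mx_dt (fun x t => (A x t)^T) x t = (mx_dt A x t)^T.
Proof.
apply/matrixP => i j; rewrite [RHS]mxE !mx_dtE.
by congr dt; apply: fun2_ext => ? ?; rewrite mxE.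
Qed.

(** * Explicit 3 by 3 matrices *)

Lemma ord3_ind (P : 'I_3 -> Prop) : P 0 -> P 1 -> P 2%:R -> forall i, P i.
Proof.
move=> h0 h1 h2 [[|[|[|//]]] hi].
- by have -> : Ordinal hi = 0 by exact: val_inj.
- by have -> : Ordinal hi = 1 by exact: val_inj.
- by have -> : Ordinal hi = 2%:R by exact: val_inj.
Qed.

Lemma mx3P (A B : 'M[R]_3) :
  [/\ [/\ A 0 0 = B 0 0, A 0 1 = B 0 1 & A 0 2%:R = B 0 2%:R],
      [/\ A 1 0 = B 1 0, A 1 1 = B 1 1 & A 1 2%:R = B 1 2%:R]
    & [/\ A 2%:R 0 = B 2%:R 0, A 2%:R 1 = B 2%:R 1 & A 2%:R 2%:R = B 2%:R 2%:R]] ->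
  A = B.
Proof.
case=> [[? ? ?] [? ? ?] [? ? ?]]; apply/matrixP.
by apply: ord3_ind; apply: ord3_ind.
Qed.

Lemma big_ord3 (V : nmodType) (F : 'I_3 -> V) : \sum_i F i = F 0 + F 1 + F 2%:R.
Proof.
rewrite !big_ord_recl big_ord0 addr0 addrA.
by congr (F _ + F _ + F _); exact: val_inj.
Qed.

Lemma mx3_eta (A : 'M[R]_3) :
  A = mx3 [:: [:: A 0 0; A 0 1; A 0 2%:R];
              [:: A 1 0; A 1 1; A 1 2%:R];
              [:: A 2%:R 0; A 2%:R 1; A 2%:R 2%:R] ].
Proof. by apply: mx3P; rewrite !mxE. Qed.

Lemma mx3_mul a b c d e f g h i a' b' c' d' e' f' g' h' i' :
  mx3 [:: [:: a; b; c]; [:: d; e; f]; [:: g; h; i] ]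
  *m mx3 [:: [:: a'; b'; c']; [:: d'; e'; f']; [:: g'; h'; i'] ] =
  mx3 [:: [:: a * a' + b * d' + c * g'; a * b' + b * e' + c * h'; a * c' + b * f' + c * i'];
          [:: d * a' + e * d' + f * g'; d * b' + e * e' + f * h'; d * c' + e * f' + f * i'];
          [:: g * a' + h * d' + i * g'; g * b' + h * e' + i * h'; g * c' + h * f' + i * i'] ].
Proof. by apply: mx3P; rewrite !mxE !big_ord3 !mxE. Qed.

Lemma mx3_tr a b c d e f g h i :
  (mx3 [:: [:: a; b; c]; [:: d; e; f]; [:: g; h; i] ])^T
  = mx3 [:: [:: a; d; g]; [:: b; e; h]; [:: c; f; i] ].
Proof. by apply: mx3P; rewrite !mxE. Qed.

Lemma mx3_add a b c d e f g h i a' b' c' d' e' f' g' h' i' :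
  mx3 [:: [:: a; b; c]; [:: d; e; f]; [:: g; h; i] ]
  + mx3 [:: [:: a'; b'; c']; [:: d'; e'; f']; [:: g'; h'; i'] ] =
  mx3 [:: [:: a + a'; b + b'; c + c']; [:: d + d'; e + e'; f + f'];
          [:: g + g'; h + h'; i + i'] ].
Proof. by apply: mx3P; rewrite !mxE. Qed.

Lemma mx3_inj a b c d e f g h i a' b' c' d' e' f' g' h' i' :
  mx3 [:: [:: a; b; c]; [:: d; e; f]; [:: g; h; i] ] =
  mx3 [:: [:: a'; b'; c']; [:: d'; e'; f']; [:: g'; h'; i'] ] ->
  [/\ [/\ a = a', b = b' & c = c'], [/\ d = d', e = e' & f = f']
    & [/\ g = g', h = h' & i = i'] ].
Proof.
move=> /matrixP E.
by do !split; [have := E 0 0|have := E 0 1|have := E 0 2%:R|have := E 1 0|have := E 1 1|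
  have := E 1 2%:R|have := E 2%:R 0|have := E 2%:R 1|have := E 2%:R 2%:R]; rewrite !mxE.
Qed.

Lemma det_mx33 (K : comNzRingType) (A : 'M[K]_3) :
  \det A = A 0 0 * (A 1 1 * A 2%:R 2%:R - A 1 2%:R * A 2%:R 1)
            - A 0 1 * (A 1 0 * A 2%:R 2%:R - A 1 2%:R * A 2%:R 0)
            + A 0 2%:R * (A 1 0 * A 2%:R 1 - A 1 1 * A 2%:R 0).
Proof.
(* With natural numbers as indices, the ordinals left by the nested cofactor expansions and the
   numerals of ['I_3] become closed terms in [bump] and [modn], which can be evaluated and
   compared. *)
pose F (i j : nat) : K := A (inord i) (inord j).
have E (i j : 'I_3) : A i j = F i j by rewrite /F !inord_val.
rewrite (expand_det_row _ 0) !big_ord_recl big_ord0 /cofactor.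
rewrite !(expand_det_row _ 0) !big_ord_recl !big_ord0 /cofactor !det_mx11.
have b1 : modn 1 3 = 1%N by [].
have b2 : modn (1 + 1) 3 = 2%N by [].
have c1 : (bump 0 0 = 1 /\ bump 0 1 = 2)%N by [].
have c2 : (bump 1 0 = 0 /\ bump 1 1 = 2)%N by [].
have c3 : (bump 2 0 = 0 /\ bump 2 1 = 1)%N by [].
rewrite !mxE /= !E /= !(b1, b2) !(c1.1, c1.2, c2.1, c2.2, c3.1, c3.2).
ring.
Qed.

Lemma det_mx3 a b c d e f g h i :
  \det (mx3 [:: [:: a; b; c]; [:: d; e; f]; [:: g; h; i] ])
  = a * (e * i - f * h) - b * (d * i - f * g) + c * (d * h - e * g).
Proof. by rewrite det_mx33 !mxE. Qed.

Section Entries.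

Variables a b c d e f g h i : R -> R -> R.
Let M x t := mx3 [:: [:: a x t; b x t; c x t]; [:: d x t; e x t; f x t];
                     [:: g x t; h x t; i x t] ].

Lemma mx_dx3 x t : mx_dx M x t =
  mx3 [:: [:: dx a x t; dx b x t; dx c x t]; [:: dx d x t; dx e x t; dx f x t];
          [:: dx g x t; dx h x t; dx i x t] ].
Proof.
apply: mx3P; rewrite !mx_dxE; do !split; rewrite !mxE; congr dx;
  apply: fun2_ext => ? ?; by rewrite mxE.
Qed.

Lemma mx_dt3 x t : mx_dt M x t =
  mx3 [:: [:: dt a x t; dt b x t; dt c x t]; [:: dt d x t; dt e x t; dt f x t];
          [:: dt g x t; dt h x t; dt i x t] ].
Proof.
apply: mx3P; rewrite !mx_dtE; do !split; rewrite !mxE; congr dt;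
  apply: fun2_ext => ? ?; by rewrite mxE.
Qed.

(** The direction from the matrix to its entries later yields smoothness of [k1] and [k2] from that
    of [invmx g *m mx_dx g]. *)
Lemma smooth_mx3 :
  [/\ [/\ smooth a, smooth b & smooth c], [/\ smooth d, smooth e & smooth f]
    & [/\ smooth g, smooth h & smooth i] ] <-> smooth_mx M.
Proof.
have E j k u : (fun x t => M x t j k) = u <-> forall x t, M x t j k = u x t.
  by split=> [<- //|]; exact: fun2_ext.
split=> [[[? ? ?] [? ? ?] [? ? ?]]|hM].
- apply: ord3_ind; apply: ord3_ind.
  + by rewrite (_ : (fun _ _ => _) = a) //; apply/E => ? ?; rewrite mxE.
  + by rewrite (_ : (fun _ _ => _) = b) //; apply/E => ? ?; rewrite mxE.
  + by rewrite (_ : (fun _ _ => _) = c) //; apply/E => ? ?; rewrite mxE.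
  + by rewrite (_ : (fun _ _ => _) = d) //; apply/E => ? ?; rewrite mxE.
  + by rewrite (_ : (fun _ _ => _) = e) //; apply/E => ? ?; rewrite mxE.
  + by rewrite (_ : (fun _ _ => _) = f) //; apply/E => ? ?; rewrite mxE.
  + by rewrite (_ : (fun _ _ => _) = g) //; apply/E => ? ?; rewrite mxE.
  + by rewrite (_ : (fun _ _ => _) = h) //; apply/E => ? ?; rewrite mxE.
  + by rewrite (_ : (fun _ _ => _) = i) //; apply/E => ? ?; rewrite mxE.
- do !split.
  + by have := hM 0 0; rewrite (_ : (fun _ _ => _) = a) //; apply/E => ? ?; rewrite mxE.
  + by have := hM 0 1; rewrite (_ : (fun _ _ => _) = b) //; apply/E => ? ?; rewrite mxE.
  + by have := hM 0 2%:R; rewrite (_ : (fun _ _ => _) = c) //; apply/E => ? ?; rewrite mxE.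
  + by have := hM 1 0; rewrite (_ : (fun _ _ => _) = d) //; apply/E => ? ?; rewrite mxE.
  + by have := hM 1 1; rewrite (_ : (fun _ _ => _) = e) //; apply/E => ? ?; rewrite mxE.
  + by have := hM 1 2%:R; rewrite (_ : (fun _ _ => _) = f) //; apply/E => ? ?; rewrite mxE.
  + by have := hM 2%:R 0; rewrite (_ : (fun _ _ => _) = g) //; apply/E => ? ?; rewrite mxE.
  + by have := hM 2%:R 1; rewrite (_ : (fun _ _ => _) = h) //; apply/E => ? ?; rewrite mxE.
  + by have := hM 2%:R 2%:R; rewrite (_ : (fun _ _ => _) = i) //; apply/E => ? ?; rewrite mxE.
Qed.

End Entries.

(** * The group SO(1,2) *)

(** The general element of the Lie algebra of SO(1,2): [a] and [b] generate the boosts along [e1]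
    and [e2], and [w] the rotation of the normal plane. *)
Definition so12 (a b w : R) : 'M[R]_3 :=
  mx3 [:: [:: 0; a; b]; [:: a; 0; - w]; [:: b; w; 0] ].

(** A cosine and a sine stand in for the angle, so that rotations varying with [(x, t)] can be
    handled without choosing an angle function. *)
Definition diag1 (p s : R) : 'M[R]_3 :=
  mx3 [:: [:: 1; 0; 0]; [:: 0; p; - s]; [:: 0; s; p] ].

Arguments so12 (a b w)%_ring_scope.
Arguments diag1 (p s)%_ring_scope.

(* Rotation by pi/2 of the normal plane, extended by 0 on the tangent. *)
Definition normal_quarter_turn : 'M[R]_3 :=
  mx3 [:: [:: 0; 0; 0]; [:: 0; 0; -1]; [:: 0; 1; 0] ].

Lemma mx3_1 : 1%:M = mx3 [:: [:: 1; 0; 0]; [:: 0; 1; 0]; [:: 0; 0; 1] ].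
Proof. by apply: mx3P; rewrite !mxE. Qed.

Lemma mx3_0 : 0 = mx3 [:: [:: 0; 0; 0]; [:: 0; 0; 0]; [:: 0; 0; 0] ].
Proof. by apply: mx3P; rewrite !mxE. Qed.

Lemma D2_invol : D2 *m D2 = 1%:M.
Proof. by rewrite /D2 mx3_mul mx3_1; congr mx3; do ! (congr cons); ring. Qed.

Lemma det_D2 : \det D2 = -1.
Proof. by rewrite det_mx3; ring. Qed.

(** Since [D2] is an involution, [A^T D2 A = D2] exhibits a left inverse. The formula is polynomial
    in the entries, hence the inverse of a smooth frame is smooth. *)
Lemma SO12_inv A : SO12 A -> invmx A = D2 *m A^T *m D2.
Proof.
case=> uA hA _; have e : (D2 *m A^T *m D2) *m A = 1%:M.
  by rewrite -!mulmxA (mulmxA A^T) hA D2_invol.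
by rewrite -[RHS]mulmx1 -(mulmxV uA) mulmxA e mul1mx.
Qed.

Lemma SO12_unit A : SO12 A -> A \in unitmx. Proof. by case. Qed.

Lemma SO12_mul A B : SO12 A -> SO12 B -> SO12 (A *m B).
Proof.
case=> uA hA dA [uB hB dB]; split; first by rewrite unitmx_mul uA uB.
  by rewrite trmx_mul -!mulmxA (mulmxA A^T) (mulmxA (A^T *m D2)) hA mulmxA.
by rewrite det_mulmx dA dB mulr1.
Qed.

Lemma SO12_inverse A : SO12 A -> SO12 (invmx A).
Proof.
case=> uA hA dA; split; first by rewrite unitmx_inv.
  rewrite -{1}hA trmx_inv -!mulmxA (mulmxA (invmx A^T)) mulVmx ?unitmx_tr // mul1mx.
  by rewrite mulmxV // mulmx1.
by rewrite det_inv dA invr1.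
Qed.

Lemma SO12_diag1 p s : p ^+ 2 + s ^+ 2 = 1 -> SO12 (diag1 p s).
Proof.
move=> ps; have d1 : \det (diag1 p s) = 1
  by rewrite det_mx3; transitivity (p ^+ 2 + s ^+ 2); [ring|].
split=> //; first by rewrite unitmxE d1 unitr1.
rewrite /diag1 /D2 mx3_tr !mx3_mul; congr mx3.
by do ! (congr cons); (ring || (transitivity (p ^+ 2 + s ^+ 2); [ring|])); done.
Qed.

(** The first row of [A^T D2 A = D2] kills the rest of the first row of [A]. The remaining 2 by 2
    block is orthogonal of determinant 1. *)
Lemma SO12_fix0 A : SO12 A -> col 0 A = col 0 1%:M ->
  exists p s, p ^+ 2 + s ^+ 2 = 1 /\ A = diag1 p s.
Proof.
move=> [_ hA dA] c0; move: hA dA.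
have e0 : A 0 0 = 1 by move/matrixP: c0 => /(_ 0 0); rewrite !mxE.
have e1 : A 1 0 = 0 by move/matrixP: c0 => /(_ 1 0); rewrite !mxE.
have e2 : A 2%:R 0 = 0 by move/matrixP: c0 => /(_ 2%:R 0); rewrite !mxE.
rewrite (mx3_eta A) e0 e1 e2.
move: (A 0 1) (A 0 2%:R) (A 1 1) (A 1 2%:R) (A 2%:R 1) (A 2%:R 2%:R).
move=> x y p q s r; rewrite /D2 mx3_tr !mx3_mul det_mx3.
move=> /mx3_inj[[_ hx hy] [_ h11 h12] [_ _ h22]] hd.
have x0 : x = 0 by lra.
have y0 : y = 0 by lra.
subst x y.
have ps : p ^+ 2 + s ^+ 2 = 1 by rewrite -h11; ring.
have orth : p * q + s * r = 0 by rewrite -h12; ring.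
have dt1 : p * r - q * s = 1 by rewrite -hd; ring.
exists p, s; split=> //; rewrite /diag1.
(* Multiplying by [p ^+ 2 + s ^+ 2 = 1] solves the linear system formed by the orthogonality and
   determinant relations, for [r] here and for [q] below. *)
have -> : r = p.
  by transitivity ((p ^+ 2 + s ^+ 2) * r); [rewrite ps mul1r|
    transitivity (p * (p * r - q * s) + s * (p * q + s * r)); [ring|rewrite dt1 orth; ring]].
have -> // : q = - s.
by transitivity ((p ^+ 2 + s ^+ 2) * q); [rewrite ps mul1r|
    transitivity (p * (p * q + s * r) - s * (p * r - q * s)); [ring|rewrite dt1 orth; ring]].
Qed.

(** [invmx g *m h] fixes the first basis vector. This serves both the independence of the Hodge star
    from the basis and the comparison of two adapted frames. *)
Lemma SO12_same_col0 g h : SO12 g -> SO12 h -> col 0 g = col 0 h ->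
  exists p s, p ^+ 2 + s ^+ 2 = 1 /\ h = g *m diag1 p s.
Proof.
move=> hg hh e; have ug := SO12_unit hg.
have [|p [s [ps E]]] := @SO12_fix0 (invmx g *m h) (SO12_mul (SO12_inverse hg) hh).
  by rewrite colE -mulmxA -colE -e colE mulmxA mulVmx // colE.
by exists p, s; split=> //; rewrite -E mulmxA mulmxV // mul1mx.
Qed.

(** The Gram matrix of the three columns is [D2], so the determinant squares to 1; the orientation
    selects the value 1. *)
Lemma pos_onb_SO12 n e1 e2 : lorentz n n = -1 -> pos_onb_normal n e1 e2 ->
  SO12 (cols3 n e1 e2).
Proof.
move=> nn [[n1 n2] [h11 h22 h12] hd].
have E : (cols3 n e1 e2)^T *m D2 *m cols3 n e1 e2 = D2.
  move: nn n1 n2 h11 h22 h12; rewrite /lorentz [cols3 _ _ _]mx3_eta !mxE /= => nn n1 n2 h11 h22 h12.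
  rewrite /D2 mx3_tr !mx3_mul; congr mx3.
  congr [:: [:: _; _; _]; [:: _; _; _]; [:: _; _; _]].
  - by apply: etrans nn; ring.
  - by apply: etrans n1; ring.
  - by apply: etrans n2; ring.
  - by apply: etrans n1; ring.
  - by apply: etrans h11; ring.
  - by apply: etrans h12; ring.
  - by apply: etrans n2; ring.
  - by apply: etrans h12; ring.
  - by apply: etrans h22; ring.
have d1 : \det (cols3 n e1 e2) = 1.
  have /eqP := congr1 determinant E.
  rewrite !det_mulmx det_tr det_D2 mulrN1 mulNr eqr_opp -expr2 sqrf_eq1.
  case/orP=> /eqP // e; move: hd; rewrite e => hd'; exfalso; apply: (Rlt_not_le _ _ hd').
  by apply: Rlt_le; exact: Ropp_lt_gt_0_contravar Rlt_0_1.
by split=> //; rewrite unitmxE d1 unitr1.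
Qed.

(** The basis chosen in [hodge_star] differs from that of [g] by a rotation of the normal plane,
    which commutes with the quarter turn. Thus the relation becomes a linear operator expressed in
    any given frame, and this expression can be differentiated. *)
Lemma hodge_star_frame (g : 'M[R]_3) v w : SO12 g -> lorentz (col 0 g) (col 0 g) = -1 ->
  hodge_star (col 0 g) v w -> w = g *m normal_quarter_turn *m invmx g *m v.
Proof.
move=> hg nn [e1 [e2 [a [b [onb -> ->]]]]].
have hh := pos_onb_SO12 nn onb; set h := cols3 _ e1 e2 in hh.
have [|p [s [ps E]]] := SO12_same_col0 hg hh.
  by apply/matrixP => i j; rewrite !mxE.
have he1 : e1 = h *m delta_mx 1 0 by rewrite -colE; apply/matrixP => i j; rewrite !mxE ord1.
have he2 : e2 = h *m delta_mx 2%:R 0 by rewrite -colE; apply/matrixP => i j; rewrite !mxE ord1.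
have Jh : g *m normal_quarter_turn *m invmx g *m h = h *m normal_quarter_turn.
  rewrite E mulmxA mulmxKV; last exact: SO12_unit.
  rewrite -!mulmxA; congr (_ *m _); rewrite /normal_quarter_turn /diag1 !mx3_mul; congr mx3.
  by do ! (congr cons); ring.
have J1 : normal_quarter_turn *m delta_mx 1 0 = delta_mx 2%:R 0 :> 'cV[R]_3.
  rewrite -colE; apply/matrixP => i j; rewrite ord1.
  by elim/ord3_ind: i; rewrite !mxE.
have J2 : normal_quarter_turn *m delta_mx 2%:R 0 = - delta_mx 1 0 :> 'cV[R]_3.
  rewrite -colE; apply/matrixP => i j; rewrite ord1.
  by elim/ord3_ind: i; rewrite !mxE //= oppr0.
have Je1 : g *m normal_quarter_turn *m invmx g *m e1 = e2.
  by rewrite {1}he1 mulmxA Jh -mulmxA J1 -he2.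
have Je2 : g *m normal_quarter_turn *m invmx g *m e2 = - e1.
  by rewrite {1}he2 mulmxA Jh -mulmxA J2 mulmxN -he1.
by rewrite mulmxDr -!scalemxAr Je1 Je2 scalerN.
Qed.

(** * Frames and their structure equations *)

Lemma mx_dx_col (m n : nat) (A : R -> R -> 'M[R]_(m, n)) j x t :
  mx_dx (fun x t => col j (A x t)) x t = col j (mx_dx A x t).
Proof.
apply/matrixP => i k; rewrite [RHS]mxE !mx_dxE.
by congr dx; apply: fun2_ext => ? ?; rewrite mxE.
Qed.

Lemma mx_dt_col (m n : nat) (A : R -> R -> 'M[R]_(m, n)) j x t :
  mx_dt (fun x t => col j (A x t)) x t = col j (mx_dt A x t).
Proof.
apply/matrixP => i k; rewrite [RHS]mxE !mx_dtE.
by congr dt; apply: fun2_ext => ? ?; rewrite mxE.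
Qed.

Lemma so12P A : A^T *m D2 + D2 *m A = 0 ->
  A = so12 (A 1 0) (A 2%:R 0) (A 2%:R 1).
Proof.
move=> hA; rewrite {1}(mx3_eta A) /so12.
move: hA; rewrite {1 2}(mx3_eta A) /D2 mx3_tr !mx3_mul mx3_add mx3_0.
move=> /mx3_inj[[h1 h2 h3] [h4 h5 h6] [h7 h8 h9]].
congr mx3; congr [:: [:: _; _; _]; [:: _; _; _]; [:: _; _; _]]; lra.
Qed.

Definition frame (g : R -> R -> 'M[R]_3) := smooth_mx g /\ forall x t, SO12 (g x t).

Lemma smooth_invmx g : frame g -> smooth_mx (fun x t => invmx (g x t)).
Proof.
case=> sg og; have -> : (fun x t => invmx (g x t)) = fun x t => D2 *m (g x t)^T *m D2.
  by apply: mxfun_ext => x t; exact: SO12_inv.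
apply: smooth_mulmx; last exact: smooth_mx_const.
by apply: smooth_mulmx; [exact: smooth_mx_const|exact: smooth_trmx].
Qed.

(** The hypothesis on [X] is the linearisation of [g^T D2 g = D2]; substituting [X = g A] turns it
    into the Lie algebra condition on [A]. Leaving [X] general covers both partial derivatives of a
    frame. *)
Lemma frame_tangent (g X : 'M[R]_3) : SO12 g -> X^T *m D2 *m g + g^T *m D2 *m X = 0 ->
  let A := invmx g *m X in X = g *m so12 (A 1 0) (A 2%:R 0) (A 2%:R 1).
Proof.
move=> og hX A; have ug := SO12_unit og.
have XE : X = g *m A.
  by rewrite /A mulmxA mulmxV // mul1mx.
rewrite -so12P // -[RHS]hX; clearbody A; rewrite XE trmx_mul; case: og => _ hg _.
by rewrite !mulmxA -(mulmxA A^T g^T) -(mulmxA A^T (g^T *m D2)) hg.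
Qed.

Lemma frame_dx g : frame g -> exists a b w, [/\ smooth a, smooth b, smooth w &
  forall x t, mx_dx g x t = g x t *m so12 (a x t) (b x t) (w x t)].
Proof.
move=> fg; case: (fg) => sg og.
have sA := smooth_mulmx (smooth_invmx fg) (smooth_mx_dx sg).
exists (fun x t => (invmx (g x t) *m mx_dx g x t) 1 0),
  (fun x t => (invmx (g x t) *m mx_dx g x t) 2%:R 0),
  (fun x t => (invmx (g x t) *m mx_dx g x t) 2%:R 1); split; try exact: sA.
move=> x t; apply: frame_tangent => //.
have e : (fun x t => (g x t)^T *m D2 *m g x t) = fun _ _ => D2.
  by apply: mxfun_ext => x' t'; case: (og x' t').
have := mx_dx_const D2 x t; rewrite -e => <-.
have sgT := smooth_trmx sg; have sD := smooth_mx_const D2.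
by rewrite (mx_dxM (smooth_mulmx sgT sD) sg) (mx_dxM sgT sD) mx_dx_const mulmx0 addr0 mx_dx_tr.
Qed.

Lemma frame_dt g : frame g -> exists a b w, [/\ smooth a, smooth b, smooth w &
  forall x t, mx_dt g x t = g x t *m so12 (a x t) (b x t) (w x t)].
Proof.
move=> fg; case: (fg) => sg og.
have sA := smooth_mulmx (smooth_invmx fg) (smooth_mx_dt sg).
exists (fun x t => (invmx (g x t) *m mx_dt g x t) 1 0),
  (fun x t => (invmx (g x t) *m mx_dt g x t) 2%:R 0),
  (fun x t => (invmx (g x t) *m mx_dt g x t) 2%:R 1); split; try exact: sA.
move=> x t; apply: frame_tangent => //.
have e : (fun x t => (g x t)^T *m D2 *m g x t) = fun _ _ => D2.
  by apply: mxfun_ext => x' t'; case: (og x' t').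
have := mx_dt_const D2 x t; rewrite -e => <-.
have sgT := smooth_trmx sg; have sD := smooth_mx_const D2.
by rewrite (mx_dtM (smooth_mulmx sgT sD) sg) (mx_dtM sgT sD) mx_dt_const mulmx0 addr0 mx_dt_tr.
Qed.

Lemma smooth_so12 a b w : smooth a -> smooth b -> smooth w ->
  smooth_mx (fun x t => so12 (a x t) (b x t) (w x t)).
Proof.
move=> ha hb hw; have h0 := smooth_const 0; have hw' := smooth_opp hw.
by apply/smooth_mx3.
Qed.

Lemma mx_dx_so12 a b w x t : mx_dx (fun x t => so12 (a x t) (b x t) (w x t)) x t =
  so12 (dx a x t) (dx b x t) (dx w x t).
Proof. by rewrite mx_dx3 !dxC dxN. Qed.

Lemma mx_dt_so12 a b w x t : mx_dt (fun x t => so12 (a x t) (b x t) (w x t)) x t =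
  so12 (dt a x t) (dt b x t) (dt w x t).
Proof. by rewrite mx_dt3 !dtC dtN. Qed.

Lemma col0_mx3_inj a b c d e f g h i a' b' c' d' e' f' g' h' i' :
  col 0 (mx3 [:: [:: a; b; c]; [:: d; e; f]; [:: g; h; i] ]) =
  col 0 (mx3 [:: [:: a'; b'; c']; [:: d'; e'; f']; [:: g'; h'; i'] ]) ->
  [/\ a = a', d = d' & g = g'].
Proof.
by move=> /matrixP E; split; [have := E 0 0|have := E 1 0|have := E 2%:R 0]; rewrite !mxE.
Qed.

Section StructureEquations.

Variables (gamma : R -> R -> 'cV[R]_3) (g : R -> R -> 'M[R]_3).
Variables k1 k2 w a b v : R -> R -> R.
Hypotheses (fg : frame g) (g0 : forall x t, col 0 (g x t) = mx_dx gamma x t).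
Hypotheses (sk1 : smooth k1) (sk2 : smooth k2) (sw : smooth w).
Hypotheses (sa : smooth a) (sb : smooth b) (sv : smooth v).
Let A x t := so12 (k1 x t) (k2 x t) (w x t).
Let B x t := so12 (a x t) (b x t) (v x t).
Hypotheses (gx : forall x t, mx_dx g x t = g x t *m A x t)
           (gt : forall x t, mx_dt g x t = g x t *m B x t).

Let sg : smooth_mx g := fg.1.
Let sA : smooth_mx A := smooth_so12 sk1 sk2 sw.
Let sB : smooth_mx B := smooth_so12 sa sb sv.

Lemma frame_cancel (x t : R) (n : nat) (X Y : 'M[R]_(3, n)) :
  g x t *m X = g x t *m Y -> X = Y.
Proof.
have u := SO12_unit (fg.2 x t); move/(congr1 (mulmx (invmx (g x t)))).
by rewrite !mulmxA mulVmx // !mul1mx.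
Qed.

(** The mixed derivatives of [g] agree: [g_x = g A] and [g_t = g B] give
    [g (B A + A_t) = g (A B + B_x)], and [g] cancels. *)
Lemma zero_curvature x t :
  [/\ dt k1 x t - dx a x t = v x t * k2 x t - w x t * b x t,
      dt k2 x t - dx b x t = w x t * a x t - v x t * k1 x t
    & dt w x t - dx v x t = k2 x t * a x t - k1 x t * b x t].
Proof.
have : B x t *m A x t + mx_dt A x t = A x t *m B x t + mx_dx B x t.
  apply: (@frame_cancel x t); rewrite !mulmxDr !mulmxA -gx -gt.
  rewrite -(mx_dxM sg sB) -(mx_dtM sg sA).
  rewrite (_ : (fun _ _ => _) = mx_dx g); last by apply: mxfun_ext.
  rewrite [in RHS](_ : (fun _ _ => _) = mx_dt g); last by apply: mxfun_ext.
  by rewrite mx_dx_dt.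
rewrite /A /B mx_dx_so12 mx_dt_so12 /so12 !mx3_mul !mx3_add.
by case/mx3_inj=> [[_ h1 h2] [h3 _ h4] [h5 h6 _]]; split; lra.
Qed.

Lemma mean_curvature_frame x t : mean_curvature gamma x t = col 0 (g x t *m A x t).
Proof.
rewrite /mean_curvature (_ : mx_dx gamma = fun x t => col 0 (g x t)); last first.
  by apply: mxfun_ext => x' t'; rewrite g0.
by rewrite mx_dx_col gx.
Qed.

Hypothesis hgamma : timelike_star_MCF gamma.

(** Since [e0 = gamma_x], the first column of [g_t] is the [x]-derivative of [gamma_t]. In the
    frame, the flow makes [gamma_t] the first column of [g H A], with [H] half the quarter turn, so
    the first columns of [B] and of [A H A + H A_x] agree. *)
Lemma tangent_evolution x t :
  a x t = - (dx k2 x t + w x t * k1 x t) / 2%:R /\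
  b x t = (dx k1 x t - w x t * k2 x t) / 2%:R.
Proof.
case: hgamma => sgam nn flow.
pose H := 2%:R^-1 *: normal_quarter_turn.
have gamt x' t' : mx_dt gamma x' t' = col 0 (g x' t' *m (H *m A x' t')).
  have [w' [hs ->]] := flow x' t'.
  move: hs; rewrite -g0 => hs; rewrite (hodge_star_frame (fg.2 x' t') _ hs) ?g0 //.
  rewrite mean_curvature_frame !colE !mulmxA mulmxKV; last exact: SO12_unit (fg.2 x' t').
  by rewrite /H -!scalemxAr -!scalemxAl.
have : col 0 (g x t *m B x t) = mx_dx (mx_dt gamma) x t.
  rewrite mx_dx_dt // -gt (_ : mx_dx gamma = fun x t => col 0 (g x t)) ?mx_dt_col //.
  by apply: mxfun_ext => x' t'; rewrite g0.
rewrite (_ : mx_dt gamma = fun x t => col 0 (g x t *m (H *m A x t))); last first.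
  exact: mxfun_ext.
have sH := smooth_mx_const H.
rewrite mx_dx_col (mx_dxM sg (smooth_mulmx sH sA)) gx (mx_dxM sH sA) mx_dx_const mul0mx add0r.
rewrite -mulmxA -mulmxDr !colE -!mulmxA => /frame_cancel; rewrite -!colE mulmxA /A mx_dx_so12.
have -> : H = mx3
  [:: [:: 0; 0; 0]; [:: 0; 0; - 2%:R^-1]; [:: 0; 2%:R^-1; 0] ].
  by apply: mx3P; rewrite !mxE /= !mulr0 mulrN1 mulr1.
rewrite /so12 !mx3_mul !mx3_add => /col0_mx3_inj[_ h1 h2].
by split; [rewrite h1|rewrite h2]; field.
Qed.

End StructureEquations.

(** * The NLS in real coordinates *)

Lemma IZR_2E : IZR 2 = 2%:R :> R.
Proof. by rewrite IZRposE INRE. Qed.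

Definition R_ringE := (RplusE, RmultE, RoppE, RminusE, RinvE, RdivE, RpowE, IZR_2E, R0E, R1E).

Lemma dxZ c f x t : dx (fun x t => c * f x t) x t = c * dx f x t.
Proof. exact: Derive_scal. Qed.

Lemma dtZ c f x t : dt (fun x t => c * f x t) x t = c * dt f x t.
Proof. exact: Derive_scal. Qed.

Lemma Cmod_sqr (z : C) : (Cmod z ^ 2)%R = z.1 ^+ 2 + z.2 ^+ 2.
Proof.
rewrite /Cmod -Rsqr_pow2 Rsqr_sqrt ?R_ringE //.
by apply/RleP; rewrite addr_ge0 ?sqr_ge0.
Qed.

(** Real and imaginary parts of the equation, with the common factor 1/2 of [q] cancelled. The
    coefficient [(k1^2 + k2^2) / 4] is [|q|^2], which is also the speed at which the sought frame
    turns in the normal plane. *)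
Lemma defocusing_NLSE k1 k2 :
  defocusing_NLS (fun x t => (RtoC (/ 2) * (k1 x t, k2 x t))%C) <->
  forall x t,
    dt k1 x t = - dx (dx k2) x t / 2%:R + (k1 x t ^+ 2 + k2 x t ^+ 2) / 4%:R * k2 x t /\
    dt k2 x t = dx (dx k1) x t / 2%:R - (k1 x t ^+ 2 + k2 x t ^+ 2) / 4%:R * k1 x t.
Proof.
have qE : (fun x t => (RtoC (/ 2) * (k1 x t, k2 x t))%C) =
    fun x t => (2%:R^-1 * k1 x t, 2%:R^-1 * k2 x t).
  apply: functional_extensionality => x; apply: functional_extensionality => t.
  by apply: injective_projections; rewrite /= !R_ringE; ring.
have dxq (f g : R -> R -> R) : C_dx (fun x t => (2%:R^-1 * f x t, 2%:R^-1 * g x t)) =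
    fun x t => (2%:R^-1 * dx f x t, 2%:R^-1 * dx g x t).
  apply: functional_extensionality => x; apply: functional_extensionality => t.
  by congr pair; exact: dxZ.
have dtq x t : C_dt (fun x t => (2%:R^-1 * k1 x t, 2%:R^-1 * k2 x t)) x t =
    (2%:R^-1 * dt k1 x t, 2%:R^-1 * dt k2 x t) by congr pair; exact: dtZ.
have e x t : (Ci / RtoC 2 *
   ((2%:R^-1 * dx (dx k1) x t, 2%:R^-1 * dx (dx k2) x t)%R
    - RtoC 2 * RtoC (2%:R^-1 * k1 x t * (2%:R^-1 * k1 x t) +
                     2%:R^-1 * k2 x t * (2%:R^-1 * k2 x t))%R *
      (2%:R^-1 * k1 x t, 2%:R^-1 * k2 x t)%R))%C =
   (2%:R^-1 * (- dx (dx k2) x t / 2%:R + (k1 x t ^+ 2 + k2 x t ^+ 2) / 4%:R * k2 x t),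
    2%:R^-1 * (dx (dx k1) x t / 2%:R - (k1 x t ^+ 2 + k2 x t ^+ 2) / 4%:R * k1 x t)).
  by apply: injective_projections => /=; rewrite !R_ringE; field; done.
have u2 : (2%:R^-1 : R) != 0 by rewrite invr_eq0 pnatr_eq0.
rewrite qE /defocusing_NLS !dxq; split=> h x t; have := h x t;
  rewrite dtq Cmod_sqr !expr2 [(2%:R^-1 * k1 x t, _).1]/= [(2%:R^-1 * k1 x t, _).2]/= e.
  by case=> /(mulfI u2) -> /(mulfI u2) ->; rewrite !expr2.
by case=> -> ->; rewrite !expr2.
Qed.

(** * Rotations and points of the unit circle *)

Lemma diag1_rotE c : diag1_rot c = diag1 (cos c) (sin c).
Proof.
apply/matrixP => i j; rewrite /diag1_rot /lift0_mx /rot2 /diag1.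
by elim/ord3_ind: i; elim/ord3_ind: j; rewrite !mxE;
  do ! (case: splitP => [] [[|[|[|//]]] ?] //= _; rewrite ?mxE).
Qed.

Lemma cos_sin_ex (p s : R) : p ^+ 2 + s ^+ 2 = 1 -> exists c, cos c = p /\ sin c = s.
Proof.
move=> h.
have hh : `|p| <= 1.
  by rewrite -(@expr_le1 _ 2) // real_normK ?num_real // -h lerDl sqr_ge0.
have hp : Rle (-1) p /\ Rle p 1 by move: hh; rewrite ler_norml => /andP[? ?]; split; apply/RleP.
have ss : sqrt (1 - Rsqr p) = Rabs s.
  by rewrite -sqrt_Rsqr_abs; congr sqrt; rewrite /Rsqr !R_ringE -h; ring.
(* [acos] reaches the upper half circle only; the lower half is obtained from the opposite angle. *)
have [s0|s0] := Rle_lt_dec 0 s.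
  exists (acos p); rewrite cos_acos // sin_acos // ss Rabs_pos_eq //.
exists (- acos p); rewrite -!RoppE cos_neg sin_neg cos_acos // sin_acos // ss Rabs_left //.
by split=> //; exact: Ropp_involutive.
Qed.

(** * Rotated frames and the initial frame *)

Lemma cos2_sin2 (c : R) : cos c ^+ 2 + sin c ^+ 2 = 1.
Proof. by have := sin2_cos2 c; rewrite /Rsqr !R_ringE !expr2 addrC. Qed.

Lemma smooth_diag1 p s : smooth p -> smooth s -> smooth_mx (fun x t => diag1 (p x t) (s x t)).
Proof.
move=> hp hs; have h0 := smooth_const 0; have h1 := smooth_const 1; have hs' := smooth_opp hs.
by apply/smooth_mx3.
Qed.

(** A change of gauge: conjugation turns the boost parts by [- th], and the derivatives of [th] add
    to the rotation speeds. *)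
Lemma rotate_frame g th k1 k2 w a b v : frame g -> smooth th ->
  (forall x t, mx_dx g x t = g x t *m so12 (k1 x t) (k2 x t) (w x t)) ->
  (forall x t, mx_dt g x t = g x t *m so12 (a x t) (b x t) (v x t)) ->
  let g' := fun x t => g x t *m diag1 (cos (th x t)) (sin (th x t)) in
  [/\ frame g', forall x t, col 0 (g' x t) = col 0 (g x t),
    forall x t, mx_dx g' x t = g' x t *m
      so12 (cos (th x t) * k1 x t + sin (th x t) * k2 x t)
           (cos (th x t) * k2 x t - sin (th x t) * k1 x t) (w x t + dx th x t)
  & forall x t, mx_dt g' x t = g' x t *m
      so12 (cos (th x t) * a x t + sin (th x t) * b x t)
           (cos (th x t) * b x t - sin (th x t) * a x t) (v x t + dt th x t)].
Proof.
move=> [sg og] sth gx gt g'.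
have sc := smooth_cos sth; have ss := smooth_sin sth.
have sQ := smooth_diag1 sc ss.
split.
- split; first exact: smooth_mulmx.
  by move=> x t; apply: SO12_mul => //; apply: SO12_diag1; exact: cos2_sin2.
- move=> x t; rewrite /g' !colE -mulmxA; congr (_ *m _); rewrite -colE.
  by apply/matrixP; elim/ord3_ind => j; rewrite !mxE //= ord1.
- move=> x t; rewrite /g' (mx_dxM sg sQ) gx -!mulmxA -mulmxDr; congr (_ *m _).
  rewrite mx_dx3 !dxC dxN dx_cos // dx_sin // /so12 /diag1 !mx3_mul mx3_add.
  have := cos2_sin2 (th x t); move: (cos _) (sin _) => c s cs.
  congr mx3; congr [:: [:: _; _; _]; [:: _; _; _]; [:: _; _; _]]; try ring.
  + by transitivity ((c ^+ 2 + s ^+ 2) * k1 x t); [rewrite cs|]; ring.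
  + by transitivity ((c ^+ 2 + s ^+ 2) * k2 x t); [rewrite cs|]; ring.
- move=> x t; rewrite /g' (mx_dtM sg sQ) gt -!mulmxA -mulmxDr; congr (_ *m _).
  rewrite mx_dt3 !dtC dtN dt_cos // dt_sin // /so12 /diag1 !mx3_mul mx3_add.
  have := cos2_sin2 (th x t); move: (cos _) (sin _) => c s cs.
  congr mx3; congr [:: [:: _; _; _]; [:: _; _; _]; [:: _; _; _]]; try ring.
  + by transitivity ((c ^+ 2 + s ^+ 2) * a x t); [rewrite cs|]; ring.
  + by transitivity ((c ^+ 2 + s ^+ 2) * b x t); [rewrite cs|]; ring.
Qed.

Lemma positive_on_line (f : R -> R) a b : (forall s, continuity_pt f s) ->
  (forall s, f s <> 0) -> Rlt 0 (f a) -> Rlt 0 (f b).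
Proof.
move=> fc f0 fa; have [//|[/esym/f0 //|fb]] := Rtotal_order 0 (f b).
have [|s [_ /f0 //]] := IVT_gen f a b 0 fc.
by rewrite Rmin_right ?Rmax_left; [split|..]; apply: Rlt_le => //; exact: Rlt_trans fa.
Qed.

(** The intermediate value theorem is applied along the path from the origin to [(x, 0)] and then to
    [(x, t)]. The sign will tell whether the tangent points to the future or to the past. *)
Lemma smooth_nonvanishing_sign f : smooth f -> (forall x t, f x t <> 0) ->
  exists s : R, s * s = 1 /\ forall x t, 0 < s * f x t.
Proof.
move=> sf f0.
have pos h : smooth h -> (forall x t, h x t <> 0) -> Rlt 0 (h 0 0) -> forall x t, 0 < h x t.
  move=> sh h0 h00 x t; apply/RltP.
  have cx y : continuity_pt (fun s => h s 0) y.
    by apply/continuity_pt_filterlim; exact: smooth_continuous_x.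
  have ct y : continuity_pt (fun s => h x s) y.
    by apply/continuity_pt_filterlim; exact: smooth_continuous_t.
  apply: (@positive_on_line (fun s => h x s) 0) => //.
  exact: (@positive_on_line (fun s => h s 0) 0).
have [lt0|[/esym/f0 //|gt0]] := Rtotal_order 0 (f 0 0).
  by exists 1; split=> [|x t]; rewrite mul1r //; exact: pos.
exists (-1); split=> [|x t]; first by rewrite mulrNN mulr1.
rewrite mulN1r; apply: (@pos (fun x t => - f x t)).
- exact: smooth_opp.
- by move=> x' t' /eqP; rewrite oppr_eq0 => /eqP /f0.
- exact: Ropp_gt_lt_0_contravar.
Qed.

(* The boost taking the time axis to e0, which depends rationally on e0; for a
   past-pointing e0 (s = -1) it is applied to - e0 and then composed with
   reflections. *)
Lemma initial_frame (e0 : R -> R -> 'cV[R]_3) : smooth_mx e0 ->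
  (forall x t, lorentz (e0 x t) (e0 x t) = -1) ->
  exists g, frame g /\ forall x t, col 0 (g x t) = e0 x t.
Proof.
move=> se hl.
pose al x t := e0 x t 0 0; pose be x t := e0 x t 1 0; pose de x t := e0 x t 2%:R 0.
have sal : smooth al by exact: se.
have sbe : smooth be by exact: se.
have sde : smooth de by exact: se.
have h4 x t : be x t ^+ 2 + de x t ^+ 2 + 1 - al x t ^+ 2 = 0.
  by have := hl x t; rewrite /lorentz -/(al x t) -/(be x t) -/(de x t) !expr2 => h; lra.
have al0 x t : al x t <> 0.
  move=> e; have := h4 x t; rewrite e expr0n /= subr0.
  have := sqr_ge0 (be x t); have := sqr_ge0 (de x t); lra.
have [s [ss sa]] := smooth_nonvanishing_sign sal al0.
have m0 x t : 1 + s * al x t <> 0 by have := sa x t; lra.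
pose d x t := (1 + s * al x t)^-1.
have h2 x t : d x t * (1 + s * al x t) - 1 = 0.
  by rewrite mulVf ?subrr //; apply/eqP.
have h3 : s * s - 1 = 0 by rewrite ss subrr.
have h1 x t : (be x t ^+ 2 + de x t ^+ 2) * d x t - (s * al x t - 1) = 0.
  transitivity (d x t * (be x t ^+ 2 + de x t ^+ 2 + 1 - al x t ^+ 2) -
    d x t * al x t ^+ 2 * (s * s - 1) + (s * al x t - 1) * (d x t * (1 + s * al x t) - 1)).
    by ring.
  by rewrite h4 h3 h2; ring.
have s1 := smooth_const 1; have sss := smooth_const s.
have sd : smooth d.
  apply: (@smooth_inv (fun x t => 1 + s * al x t)) => //.
  by apply: smooth_add => //; exact: smooth_mul.
(* The boost of [s * e0] with its first and third columns multiplied by [s]: the first restores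
   [e0], and changing the third as well keeps the determinant equal to 1. *)
pose g x t := mx3
  [:: [:: al x t; s * be x t; de x t];
      [:: be x t; 1 + be x t * be x t * d x t; s * (be x t * de x t * d x t)];
      [:: de x t; be x t * de x t * d x t; s * (1 + de x t * de x t * d x t)] ].
exists g; split; last first.
  move=> x t; apply/matrixP; elim/ord3_ind => j; rewrite !mxE ord1 //=.
split.
  apply/smooth_mx3; do !split => //; repeat first [apply: smooth_add | apply: smooth_mul]; done.
move=> x t.
have dg : \det (g x t) = 1.
  rewrite /g det_mx3; apply/eqP; rewrite -subr_eq0; apply/eqP.
  move: (h1 x t) (h2 x t) (h4 x t); move: (al x t) (be x t) (de x t) (d x t) => A B D d' H1 H2 H4.
  transitivity (A * s * ((B ^+ 2 + D ^+ 2) * d' - (s * A - 1)) + (A ^+ 2 - B ^+ 2) * (s * s - 1)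
    - (B ^+ 2 + D ^+ 2 + 1 - A ^+ 2)); first by ring.
  by rewrite H1 H4 h3; ring.
split; [by rewrite unitmxE dg unitr1| |by []].
rewrite /g /D2 mx3_tr !mx3_mul.
move: (h1 x t) (h2 x t) (h4 x t); move: (al x t) (be x t) (de x t) (d x t) => A B D d' H1 H2 H4.
pose E1 := (B ^+ 2 + D ^+ 2) * d' - (s * A - 1).
pose E2 := d' * (1 + s * A) - 1.
pose E3 := s * s - 1.
pose E4 := B ^+ 2 + D ^+ 2 + 1 - A ^+ 2.
(* Each entry of [g^T D2 g] is its expected value [c0] plus a combination of the vanishing
   expressions [E1] to [E4]. The coefficients supplied below make every case a polynomial
   identity. *)
have comb c0 c1 c2 c3 c4 : c0 = c0 + c1 * E1 + c2 * E2 + c3 * E3 + c4 * E4.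
  by rewrite /E1 /E2 /E3 /E4 H1 H2 h3 H4; ring.
congr mx3; congr [:: [:: _; _; _]; [:: _; _; _]; [:: _; _; _]]; apply/esym.
- by apply: (etrans (comb (-1) 0 0 0 1)); rewrite /E1 /E2 /E3 /E4; ring.
- by apply: (etrans (comb 0 B 0 0 0)); rewrite /E1 /E2 /E3 /E4; ring.
- by apply: (etrans (comb 0 (D * s) 0 (D * A) 0)); rewrite /E1 /E2 /E3 /E4; ring.
- by apply: (etrans (comb 0 B 0 0 0)); rewrite /E1 /E2 /E3 /E4; ring.
- by apply: (etrans (comb 1 (B ^+ 2 * d') (B ^+ 2) (- B ^+ 2) 0)); rewrite /E1 /E2 /E3 /E4; ring.
- by apply: (etrans (comb 0 (s * B * D * d') (s * B * D) 0 0)); rewrite /E1 /E2 /E3 /E4; ring.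
- by apply: (etrans (comb 0 (D * s) 0 (D * A) 0)); rewrite /E1 /E2 /E3 /E4; ring.
- by apply: (etrans (comb 0 (s * B * D * d') (s * B * D) 0 0)); rewrite /E1 /E2 /E3 /E4; ring.
- apply: (etrans (comb 1 (D ^+ 2 * d') (D ^+ 2) (1 + 2%:R * D ^+ 2 * d' +
    D ^+ 2 * d' * ((B ^+ 2 + D ^+ 2) * d')) 0)); rewrite /E1 /E2 /E3 /E4; ring.
Qed.

(** * Adapted frames *)

Lemma parallel_frame gamma : timelike_star_MCF gamma ->
  exists g k1 k2 a b v,
    [/\ frame g /\ (forall x t, col 0 (g x t) = mx_dx gamma x t),
        [/\ smooth k1, smooth k2, smooth a, smooth b & smooth v],
        forall x t, mx_dx g x t = g x t *m so12 (k1 x t) (k2 x t) 0,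
        forall x t, mx_dt g x t = g x t *m so12 (a x t) (b x t) (v x t)
      & forall x t, v x t = (k1 x t ^+ 2 + k2 x t ^+ 2) / 4%:R].
Proof.
move=> mcf; case: (mcf) => sgam nn _.
have [g [fg g0]] := initial_frame (smooth_mx_dx sgam) nn.
have [k1 [k2 [w [sk1 sk2 sw gx]]]] := frame_dx fg.
have [a [b [v [sa sb sv gt]]]] := frame_dt fg.
have ev := tangent_evolution fg g0 sk1 sk2 sw gx gt mcf.
have zc := zero_curvature fg sk1 sk2 sw sa sb sv gx gt.
pose n x t := (k1 x t * k1 x t + k2 x t * k2 x t) * 4%:R^-1.
have s11 := smooth_mul sk1 sk1; have s22 := smooth_mul sk2 sk2.
have s4 := smooth_const 4%:R^-1.
have sn : smooth n by exact: smooth_mul (smooth_add s11 s22) s4.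
have sp := smooth_opp sw; have sq := smooth_add sn (smooth_opp sv).
(* Closedness of [- w dx + (n - v) dt] is the third curvature equation: once [a] and [b] are
   replaced by their values, the terms in [w] cancel and the right side becomes [- dx n]. *)
have [x t|th [sth thx tht]] := poincare sp sq.
  rewrite dtN dxD //; last exact: smooth_opp.
  rewrite dxN (dxM _ _ (smooth_add s11 s22) s4) dxC (dxD _ _ s11 s22) !dxM //.
  have [_ _] := zc x t; have [-> ->] := ev x t => h; lra.
have [fg' g0' gx' gt'] := rotate_frame fg sth gx gt.
have sc := smooth_cos sth; have ss := smooth_sin sth.
do 6 eexists; split; first split.
- exact: fg'.
- by move=> x t; rewrite g0'.
- split; last first.
  + exact: smooth_add sv (smooth_dt sth).
  + exact: smooth_add (smooth_mul sc sb) (smooth_opp (smooth_mul ss sa)).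
  + exact: smooth_add (smooth_mul sc sa) (smooth_mul ss sb).
  + exact: smooth_add (smooth_mul sc sk2) (smooth_opp (smooth_mul ss sk1)).
  + exact: smooth_add (smooth_mul sc sk1) (smooth_mul ss sk2).
- by move=> x t; rewrite gx' thx subrr.
- exact: gt'.
(* The new speed is [v + (n - v) = n]. Rotation preserves [k1^2 + k2^2], so [n] has the required
   form in the new curvatures too. *)
- move=> x t; rewrite /= tht /n; have := cos2_sin2 (th x t).
  move: (cos _) (sin _) => c s cs.
  transitivity ((c ^+ 2 + s ^+ 2) * (k1 x t ^+ 2 + k2 x t ^+ 2) / 4%:R); last by field.
  by rewrite cs; field.
Qed.

Lemma adapted_frame_exists gamma : timelike_star_MCF gamma ->
  exists g k1 k2, adapted_frame gamma g k1 k2.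
Proof.
move=> mcf.
have [g [k1 [k2 [a [b [v [[fg g0] [sk1 sk2 sa sb sv] gx gt vE]]]]]]] := parallel_frame mcf.
have s0 := smooth_const 0.
have ev := tangent_evolution fg g0 sk1 sk2 s0 gx gt mcf.
have zc := zero_curvature fg sk1 sk2 s0 sa sb sv gx gt.
exists g, k1, k2; split; try by case: fg.
- move=> x t; rewrite gx mulmxA mulVmx ?mul1mx; last exact: SO12_unit (fg.2 x t).
  by rewrite /so12 oppr0.
apply/defocusing_NLSE => x t; rewrite -vE.
(* With [w = 0], [a = - dx k2 / 2] and [b = dx k1 / 2], the first two curvature equations are the
   two real components of the NLS. *)
have [h1 h2 _] := zc x t.
have aE : a = fun x t => - 2%:R^-1 * dx k2 x t.
  by apply: fun2_ext => x' t'; have [-> _] := ev x' t'; field.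
have bE : b = fun x t => 2%:R^-1 * dx k1 x t.
  by apply: fun2_ext => x' t'; have [_ ->] := ev x' t'; field.
by move: h1 h2; rewrite aE bE !dxZ => h1 h2; split; lra.
Qed.

(** * Uniqueness up to a constant rotation *)

Lemma adapted_frame_dx gamma g k1 k2 : adapted_frame gamma g k1 k2 ->
  [/\ frame g, smooth k1, smooth k2 &
    forall x t, mx_dx g x t = g x t *m so12 (k1 x t) (k2 x t) 0].
Proof.
case=> sg og _ gK _; have fg : frame g by [].
have : smooth_mx (fun x t => invmx (g x t) *m mx_dx g x t).
  exact: smooth_mulmx (smooth_invmx fg) (smooth_mx_dx sg).
rewrite (mxfun_ext gK) => /smooth_mx3[[_ sk1 sk2] _ _]; split=> // x t.
by rewrite /so12 oppr0 -gK mulmxA mulmxV ?mul1mx //; exact: SO12_unit.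
Qed.

Lemma normal_rotation_speed gamma g k1 k2 : timelike_star_MCF gamma ->
  curved_at_dense_times gamma -> adapted_frame gamma g k1 k2 ->
  exists a b, forall x t, mx_dt g x t =
    g x t *m so12 (a x t) (b x t) ((k1 x t ^+ 2 + k2 x t ^+ 2) / 4%:R).
Proof.
move=> mcf dense af; have [fg sk1 sk2 gx] := adapted_frame_dx af.
have [_ _ g0 _ /defocusing_NLSE nls] := af.
have [a [b [v [sa sb sv gt]]]] := frame_dt fg.
have s0 := smooth_const 0.
have ev := tangent_evolution fg g0 sk1 sk2 s0 gx gt mcf.
have zc := zero_curvature fg sk1 sk2 s0 sa sb sv gx gt.
have aE : a = fun x t => - 2%:R^-1 * dx k2 x t.
  by apply: fun2_ext => x' t'; have [-> _] := ev x' t'; field.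
have bE : b = fun x t => 2%:R^-1 * dx k1 x t.
  by apply: fun2_ext => x' t'; have [_ ->] := ev x' t'; field.
(* The defect [f] is to vanish. The third curvature equation makes it independent of [x], and
   subtracting the NLS from the first two gives [f k1 = f k2 = 0]. *)
pose f x t := v x t - (k1 x t * k1 x t + k2 x t * k2 x t) * 4%:R^-1.
have s11 := smooth_mul sk1 sk1; have s22 := smooth_mul sk2 sk2.
have s4 := smooth_const 4%:R^-1.
have sn := smooth_mul (smooth_add s11 s22) s4.
have sf : smooth f by exact: smooth_add sv (smooth_opp sn).
have fx x y t : f x t = f y t.
  apply: dx0_const => // z; rewrite /f (dxD _ _ sv (smooth_opp sn)) dxN.
  rewrite (dxM _ _ (smooth_add s11 s22) s4) dxC (dxD _ _ s11 s22) !dxM //.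
  by have [_ _] := zc z t; rewrite dtC aE bE => h; lra.
have fk x t : f x t * k1 x t = 0 /\ f x t * k2 x t = 0.
  have [h1 h2 _] := zc x t; have [n1 n2] := nls x t.
  by move: h1 h2; rewrite aE bE !dxZ n1 n2 /f !expr2 => h1 h2; split; lra.
suff f0 x t : f x t = 0.
  exists a, b => x t; rewrite gt; congr (_ *m so12 _ _ _).
  by apply/eqP; rewrite -subr_eq0 -(f0 x t) /f !expr2.
have [//|nz] := Req_dec (f x t) 0; exfalso.
(* A nonzero value persists at [(x, s)] for all times [s] within [d] of [t], and density supplies
   such an [s] with a point [y] where the curve bends. *)
have [d hd] := continuity_2d_pt_neq_0 _ _ _ (smooth_continuity x t sf) nz.
have [|y [s [lts gts H]]] := dense (Rminus t d) (Rplus t d).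
  by have := cond_pos d; Lra.lra.
apply: H; rewrite (mean_curvature_frame g0 gx).
have fs : f x s <> 0.
  apply: hd; first by rewrite Rminus_diag Rabs_R0; exact: cond_pos.
  by apply: Rabs_def1; Lra.lra.
(* As [f] does not depend on [x], it is also nonzero at [(y, s)]. Hence [k1] and [k2] vanish there,
   and with them the mean curvature vector, a contradiction. *)
have [k10 k20] := fk y s; move: k10 k20; rewrite (fx y x) => /eqP k10 /eqP k20.
move: k10 k20; rewrite !mulf_eq0 => /orP[/eqP//|/eqP k10] /orP[/eqP//|/eqP k20].
rewrite k10 k20 !colE -mulmxA -colE (_ : col 0 _ = 0) ?mulmx0 //.
by apply/matrixP; elim/ord3_ind => j; rewrite !mxE.
Qed.

Lemma adapted_frame_unique gamma g g' k1 k2 k1' k2' : timelike_star_MCF gamma ->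
  curved_at_dense_times gamma ->
  adapted_frame gamma g k1 k2 -> adapted_frame gamma g' k1' k2' ->
  exists c, forall x t,
    [/\ g' x t = g x t *m diag1 (cos c) (sin c),
        k1' x t = cos c * k1 x t + sin c * k2 x t
      & k2' x t = cos c * k2 x t - sin c * k1 x t].
Proof.
move=> mcf dense af af'.
have [fg sk1 sk2 gx] := adapted_frame_dx af.
have [fg' sk1' sk2' gx'] := adapted_frame_dx af'.
have [a [b gt]] := normal_rotation_speed mcf dense af.
have [a' [b' gt']] := normal_rotation_speed mcf dense af'.
have [_ _ g0 _ _] := af; have [_ _ g0' _ _] := af'.
have sQ := smooth_mulmx (smooth_invmx fg) fg'.1.
(* The rotation relating the frames is so far known only pointwise; reading [p] and [s] as matrix
   entries makes them smooth. *)
pose p x t := (invmx (g x t) *m g' x t) 1 1.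
pose s x t := (invmx (g x t) *m g' x t) 2%:R 1.
have sp : smooth p by exact: sQ.
have ss : smooth s by exact: sQ.
have QE x t : p x t ^+ 2 + s x t ^+ 2 = 1 /\ g' x t = g x t *m diag1 (p x t) (s x t).
  have [|p0 [s0 [h E]]] := SO12_same_col0 (fg.2 x t) (fg'.2 x t); first by rewrite g0 g0'.
  have -> : p x t = p0.
    by rewrite /p E mulmxA mulVmx ?mul1mx ?mxE //; exact: SO12_unit (fg.2 x t).
  have -> : s x t = s0.
    by rewrite /s E mulmxA mulVmx ?mul1mx ?mxE //; exact: SO12_unit (fg.2 x t).
  by [].
have g'E : g' = fun x t => g x t *m diag1 (p x t) (s x t).
  by apply: mxfun_ext => x t; case: (QE x t).
have sD := smooth_diag1 sp ss.
(* Neither frame turns in the normal plane along [x], so the normal blocks reduce to the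
   [x]-derivative of the rotation being zero. The first row gives the new curvatures. *)
have hx x t : [/\ dx p x t = 0, dx s x t = 0,
    k1' x t = p x t * k1 x t + s x t * k2 x t & k2' x t = p x t * k2 x t - s x t * k1 x t].
  have := gx' x t; rewrite {1 2}g'E (mx_dxM fg.1 sD) gx -!mulmxA -mulmxDr.
  move/(frame_cancel fg); rewrite mx_dx3 !dxC dxN /so12 /diag1 !mx3_mul mx3_add.
  by case/mx3_inj=> [[_ h1 h2] [_ h3 _] [_ h4 _]]; split; lra.
have nk x t : k1' x t ^+ 2 + k2' x t ^+ 2 = k1 x t ^+ 2 + k2 x t ^+ 2.
  have [_ _ -> ->] := hx x t; have [ps _] := QE x t.
  transitivity ((p x t ^+ 2 + s x t ^+ 2) * (k1 x t ^+ 2 + k2 x t ^+ 2)); first by ring.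
  by rewrite ps mul1r.
(* By [nk] both frames turn at the same speed in [t]. As plane rotations commute with the quarter
   turn, these contributions cancel and the rotation is constant in time. *)
have ht x t : dt p x t = 0 /\ dt s x t = 0.
  have := gt' x t; rewrite {1 2}g'E (mx_dtM fg.1 sD) gt -!mulmxA -mulmxDr.
  move/(frame_cancel fg); rewrite mx_dt3 !dtC dtN /so12 /diag1 !mx3_mul mx3_add nk.
  by case/mx3_inj=> [_ [_ h3 _] [_ h4 _]]; split; lra.
have pc x t : p x t = p 0 0.
  rewrite (dx0_const sp (fun z => let: And4 h _ _ _ := hx z t in h) x 0).
  exact: (dt0_const sp (fun z => (ht 0 z).1)).
have sc x t : s x t = s 0 0.
  rewrite (dx0_const ss (fun z => let: And4 _ h _ _ := hx z t in h) x 0).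
  exact: (dt0_const ss (fun z => (ht 0 z).2)).
(* Because [p] and [s] are constant, an angle is needed at the origin only. *)
have [c [cp cs]] := cos_sin_ex (QE 0 0).1.
exists c => x t; rewrite cp cs -(pc x t) -(sc x t).
by have [_ _ ? ?] := hx x t; split=> //; case: (QE x t).
Qed.

Theorem theorem8p1 (gamma : R -> R -> 'cV[R]_3)
    (hgamma : timelike_star_MCF gamma) :
  (exists (g : R -> R -> 'M[R]_3) (k1 k2 : R -> R -> R),
     adapted_frame gamma g k1 k2)
  /\
  (curved_at_dense_times gamma ->
   forall (g g' : R -> R -> 'M[R]_3) (k1 k2 k1' k2' : R -> R -> R),
     adapted_frame gamma g k1 k2 ->
     adapted_frame gamma g' k1' k2' ->
     exists c : R, forall x t : R,
       g' x t = g x t *m diag1_rot c /\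
       ((k1' x t, k2' x t) : C) = (expi (- c) * (k1 x t, k2 x t))%C).
Proof.
split; first exact: adapted_frame_exists.
move=> dense g g' k1 k2 k1' k2' af af'.
have [c hc] := adapted_frame_unique hgamma dense af af'.
exists c => x t; have [hg h1 h2] := hc x t; rewrite diag1_rotE; split=> //.
rewrite h1 h2; apply: injective_projections => /=;
  rewrite cos_neg sin_neg !R_ringE; ring.
Qed.
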